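(* Consider the nonhomogeneous frog model on $\mathbb{Z}$ with frog counts $(X_j)_{j\ge 1}$ and left-step probabilities $(p_j)_{j\ge 0}$, and for each $j\ge 1$ let $f_j(s)=\mathbb{E}[s^{X_j}]$ be the probability generating function of $X_j$. The model is transient if and only if $$\sum_{n=2}^{\infty}\prod_{j=1}^{n-1}f_j\left(1-\left(\frac{1-p_j}{p_j}\right)^{n-j}\right)=\infty .$$
   Context: The nonhomogeneous frog model on $\mathbb{Z}$ is the following discrete-time system of interacting random walks. At time $0$ there is one active frog at the origin $0$, no frogs at negative integers, and $X_j$ sleeping frogs at $x=j$ for each $j\ge 1$. The $X_j$ are independent random variables with values in $\{0,1,2,\dots\}$, with $\mathbb{P}(X_j\ge 1)>0$ for every $j$, and $X_{j+1}\succeq X_j$ for all $j\ge 1$, where $\succeq$ denotes stochastic dominance (i.e. $\mathbb{P}(X_{j+1}\ge k)\ge \mathbb{P}(X_j\ge k)$ for all $k$). An active frog performs a nearest-neighbor random walk on $\mathbb{Z}$; a sleeping frog stays put until an active frog lands on its vertex, at which moment all sleeping frogs at that vertex become active and begin their own random walks. Each frog originating at $x=j$ ($j\ge 0$), once active, at each step goes left with probability $p_j$ and right with probability $1-p_j$, where $\frac12<p_j<1$ for all $j\ge 0$ and the sequence $(p_j)_{j\ge 1}$ is decreasing in the weak sense ($p_{j+1}\le p_j$). All random walks are mutually independent and independent of the $X_j$. The model is called transient if the probability that infinitely many distinct frogs hit the origin is $0$; otherwise it is non-transient. *)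

(* Defs.v *)
From HB Require Import structures.
From mathcomp Require Import all_boot all_order all_algebra.
From mathcomp Require Import all_classical all_reals all_analysis.

Set Implicit Arguments.
Unset Strict Implicit.
Unset Printing Implicit Defensive.

Import Order.TTheory GRing.Theory Num.Theory.

Local Open Scope classical_set_scope.
Local Open Scope ring_scope.

Definition mutual_indep_systems d (T : measurableType d) (R : realType)
    (P : probability T R) (I : eqType) (F : I -> set_system T) : Prop :=
  forall (J : seq I) (A : I -> set T),
    uniq J -> (forall i, i \in J -> F i (A i)) ->
    P (\bigcap_(i in [set` J]) A i) = (\prod_(i <- J) P (A i))%E.

Definition sigma_of_RV d (T : measurableType d) (R : realType)
    (P : probability T R) d' (T' : measurableType d') (X : {RV P >-> T'}) :
    set_system T :=
  preimage_set_system setT X measurable.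

(* The frogs are labelled by pairs (j, i): frog (j, i) is the i-th frog that
   starts at j >= 0.  L j i k w = true means that in the outcome w the k-th
   step (k >= 0) of this frog after its activation goes to the left.  The steps
   are given for all i, but only the labels with i < frogs_at X j w are frogs of
   the model.  X 0 is never used, since there is exactly one frog at the
   origin. *)

Definition frogs_at (T : Type) (X : nat -> T -> nat) (j : nat) (w : T) : nat :=
  if j is 0%N then 1%N else X j w.

Definition walk (T : Type) (L : nat -> nat -> nat -> T -> bool)
    (j i k : nat) (w : T) : int :=
  j%:Z + \sum_(l < k) (if L j i l w then -1 else 1).

(* age X L w n j = Some a when, at time n, the frogs of site j have been active
   for a steps, and None when site j has not been hit by time n.  A site hit at
   time n by an active frog has age 0 at time n, so that its frogs make their
   first step at time n + 1. *)
Fixpoint age (T : Type) (X : nat -> T -> nat)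
    (L : nat -> nat -> nat -> T -> bool) (w : T) (n j : nat) : option nat :=
  match n with
  | 0%N => if j == 0%N then Some 0%N else None
  | m.+1 =>
      if age X L w m j is Some a then Some a.+1
      else if `[< exists x i a : nat,
                    [/\ (i < frogs_at X x w)%N, age X L w m x = Some a
                      & walk L x i a.+1 w = j%:Z] >]
           then Some 0%N else None
  end.

Definition hits_origin (T : Type) (X : nat -> T -> nat)
    (L : nat -> nat -> nat -> T -> bool) (w : T) (f : nat * nat) : Prop :=
  (f.2 < frogs_at X f.1 w)%N /\
  exists n a : nat, age X L w n f.1 = Some a /\ walk L f.1 f.2 a w = 0.

Definition transient d (T : measurableType d) (R : realType)
    (P : probability T R) (X : nat -> T -> nat)
    (L : nat -> nat -> nat -> T -> bool) : Prop :=
  P [set w | infinite_set [set f | hits_origin X L w f]] = 0%E.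

(* Joint independence of the counts X j (j >= 1) and of all the steps. *)
Definition frog_independence d (T : measurableType d) (R : realType)
    (P : probability T R) (X : nat -> {RV P >-> nat})
    (L : nat -> nat -> nat -> {RV P >-> bool}) : Prop :=
  mutual_indep_systems P
    (fun u : (nat + nat * nat * nat)%type =>
       match u with
       | inl j => sigma_of_RV (X j.+1)
       | inr (j, i, k) => sigma_of_RV (L j i k)
       end).

(* The expectation is finite for |s| <= 1, so fine loses nothing there. *)
Definition pgf d (T : measurableType d) (R : realType) (P : probability T R)
    (X : T -> nat) (s : R) : R :=
  fine ('E_P[fun w => (s ^+ X w)%R])%E.

(* Main.v *)
Require Import Defs.
From HB Require Import structures.
From mathcomp Require Import all_boot all_order all_algebra.
From mathcomp Require Import all_classical all_reals all_analysis.
From mathcomp Require Import measurable_realfun.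
From mathcomp Require Import zify ring lra.

Set Implicit Arguments.
Unset Strict Implicit.
Unset Printing Implicit Defensive.

Import Order.TTheory GRing.Theory Num.Theory.
Import numFieldNormedType.Exports.

Local Open Scope classical_set_scope.
Local Open Scope ring_scope.

(** A frog drifts to the left, so once it is active it hits the origin almost
    surely, and it almost surely stays below some level. Hence infinitely many
    frogs hit the origin exactly when all sites wake up, up to a null event.
    Call [n >= 1] a gap if, when all the frogs of the sites [0, ..., n - 1] are
    made to walk, none of them ever visits [n]. Steps have length one, so no site
    at or beyond a gap ever wakes up ([gap_age]); and if there is no gap, then all
    sites wake up ([no_gap_woken]). The model is therefore transient if and only
    if there is almost surely a gap.

    A walk from [j] ever climbs by [m] with probability [r_j ^ m], where
    [r_j = (1 - p_j) / p_j] ([up_prob], from [hlim_transient]). Conditioning on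
    [X_j], the frogs of site [j] all fail to reach [n] with probability
    [f_j (1 - r_j ^ (n - j))] ([silent_prob]), and by independence of the sites
    the frogs of [1, ..., n - 1] all fail with probability [b_n], the product in
    the statement ([quiet_prob]). Adding the frog of the origin, [n] is a gap with
    probability [(1 - r_0 ^ n) b_n] ([gap_prob]).

    Suppose that the sum of the [b_n] is infinite. Given that the first gap is [m],
    a site [n > m] is a gap exactly when the frogs of [m, ..., n - 1] all miss it,
    independently of the frogs below [m]. Because the counts increase
    stochastically and the drifts to the left weaken with the site, this has
    probability at most [b_(n - m + 1)] ([quiet_le]). So the probability of a gap
    at [n] is at most the convolution of the law of the first gap with the [b_k]
    ([gap_renewal]). Summing over [n <= N], the probability that there is no gap,
    times [b_1 + ... + b_N], is at most the sum of the [r_0 ^ n], which is finite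
    ([renewal_bound]); so that probability is zero.

    Suppose that the sum of the [b_n] is finite. Then its tail from some [N] on is
    less than 1, and with positive probability every [n >= N] is visited by a frog
    of [1, ..., n - 1]. Independently, the frog of the origin starts with [N] steps
    to the right with positive probability. On both events there is no gap
    ([transient_divergence]).

    The independence of events that involve infinitely many steps comes from the
    hypothesis on finite families by a pi-lambda argument ([block_indep]). *)

(** * Independence of blocks of coordinates *)

Section BlockIndependence.
Context d (T : measurableType d) (R : realType) (P : probability T R).
Context (I : choiceType) (F : I -> set_system T).

Definition cylinder (S : set I) : set_system T :=
  [set A | exists (J : seq I) (E : I -> set T),
    [/\ uniq J, forall i, i \in J -> S i /\ F i (E i)
      & A = \bigcap_(i in [set` J]) E i]].

Definition block (S : set I) : set_system T := <<s cylinder S >>.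

Hypothesis Fm : forall i, F i `<=` measurable.
Hypothesis FI : forall i, setI_closed (F i).
Hypothesis Findep : mutual_indep_systems P F.

Lemma cylinderI S : setI_closed (cylinder S).
Proof.
move=> A B [J1 [E1 [u1 h1 ->]]] [J2 [E2 [u2 h2 ->]]].
(* On indices common to both lists the two constraints are merged into one. *)
pose E i := if i \in J1 then if i \in J2 then E1 i `&` E2 i else E1 i else E2 i.
exists (undup (J1 ++ J2)), E; split.
- exact: undup_uniq.
- move=> i; rewrite mem_undup mem_cat /E.
  case: ifPn => [i1 _|_ /= i2]; last exact: h2.
  have [Si F1] := h1 _ i1; case: ifPn => // i2.
  by split=> //; apply: FI => //; have [] := h2 _ i2.
- apply/seteqP; split=> [w [w1 w2] i /=|w wE].
    rewrite mem_undup mem_cat /E; case: ifPn => [i1 _|_ /= i2]; last exact: w2.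
    by case: ifPn => i2; [split; [exact: w1|exact: w2]|exact: w1].
  split=> i /= iJ; have := wE i; rewrite /= mem_undup mem_cat iJ ?orbT => /(_ isT).
    by rewrite /E iJ; case: ifPn => // _ [].
  by rewrite /E iJ; case: ifPn => // _ [].
Qed.

Lemma cylinder_measurable S : cylinder S `<=` measurable.
Proof.
move=> A [J [E [_ h ->]]]; rewrite bigcap_seq.
rewrite big_seq; apply: big_ind => //; first exact: measurableI.
by move=> i iJ; exact: (@Fm i _ (h _ iJ).2).
Qed.

Lemma block_measurable S : block S `<=` measurable.
Proof.
apply: smallest_sub; last exact: cylinder_measurable.
exact: sigma_algebra_measurable.
Qed.

Lemma block_sigma_algebra S : sigma_algebra setT (block S).
Proof. exact: smallest_sigma_algebra. Qed.

(** Both cylinders are finite intersections over disjoint index lists, so that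
    their intersection is one over the concatenated list. *)
Lemma cylinder_indep S1 S2 A B : S1 `&` S2 = set0 ->
  cylinder S1 A -> cylinder S2 B -> P (A `&` B) = (P A * P B)%E.
Proof.
move=> S12 [J1 [E1 [u1 h1 ->]]] [J2 [E2 [u2 h2 ->]]].
have dis i : i \in J1 -> i \in J2 -> False.
  move=> /h1[s1 _] /h2[s2 _].
  by have : (S1 `&` S2) i by []; rewrite S12.
pose E i := if i \in J1 then E1 i else E2 i.
have -> : \bigcap_(i in [set` J1]) E1 i `&` \bigcap_(i in [set` J2]) E2 i =
    \bigcap_(i in [set` J1 ++ J2]) E i.
  apply/seteqP; split=> [w [w1 w2] i /=|w wE].
    rewrite mem_cat /E; case: ifPn => [i1 _|_ /=]; [exact: w1|exact: w2].
  split=> i /= iJ; have := wE i; rewrite /= mem_cat iJ ?orbT => /(_ isT).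
    by rewrite /E iJ.
  by rewrite /E; case: ifPn => // /dis /(_ iJ).
rewrite !Findep //.
- rewrite big_cat /=; congr (_ * _)%E; apply: eq_big_seq => i iJ.
    by rewrite /E iJ.
  by rewrite /E; case: ifPn => // /dis /(_ iJ).
- by move=> i /h2[].
- by move=> i /h1[].
- rewrite cat_uniq u1 u2 andbT; apply/hasPn => i i2; apply/negP => i1.
  exact: dis i1 i2.
- move=> i; rewrite mem_cat /E; case: ifPn => [/h1[] //|_ /= /h2[] //].
Qed.

(** Independence of a fixed event survives proper differences and increasing
    unions, the two closure properties that the pi-lambda theorem asks for. *)
Lemma indep_lambda_system B : measurable B ->
  lambda_system setT [set A | measurable A /\ P (A `&` B) = (P A * P B)%E].
Proof.
move=> mB; have PBfin : P B \is a fin_num by exact: fin_num_measure.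
split => //.
- by split=> //; rewrite setTI probability_setT mul1e.
- move=> A C CA [mA hA] [mC hC]; split; first exact: measurableD.
  have -> : (A `\` C) `&` B = (A `&` B) `\` (C `&` B).
    apply/seteqP; split=> w /=; first by move=> [[? nC] ?]; split=> // -[].
    by move=> [[? ?] nC]; split=> //; split=> // ?; apply: nC.
  have fin D : measurable D -> (P D < +oo)%E.
    by move=> mD; rewrite ltey_eq fin_num_measure.
  have mAB := measurableI _ _ mA mB; have mCB := measurableI _ _ mC mB.
  have hAD : P (A `\` C) = (P A - P C)%E.
    by rewrite measureD ?fin// setIidr.
  transitivity (P (A `&` B) - P (C `&` B))%E.
    rewrite measureD ?fin//; congr (_ - P _)%E.
    by rewrite setIidr//; exact: setSI.
  rewrite hAD hA hC muleBl// fin_num_adde_defr//; exact: fin_num_measure.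
- move=> G ndG hG.
  have mG n : measurable (G n) by have [] := hG n.
  have mU : measurable (\bigcup_n G n) by exact: bigcup_measurable.
  split=> //.
  have c1 : P (G n `&` B) @[n --> \oo] --> P ((\bigcup_n G n) `&` B).
    rewrite setI_bigcupl; apply: nondecreasing_cvg_mu.
    - by move=> n; exact: measurableI.
    - by apply: bigcup_measurable => n _; exact: measurableI.
    - by move=> m n mn; apply/subsetPset; apply: setSI; apply/subsetPset/ndG.
  have c2 : (P (G n) * P B)%E @[n --> \oo] --> (P (\bigcup_n G n) * P B)%E.
    apply: cvgeZr => //; exact: nondecreasing_cvg_mu.
  rewrite -(cvg_lim _ c1)// -(cvg_lim _ c2)//; congr (lim (_ @ \oo)).
  by apply/funext => n; have [] := hG n.
Qed.

(** The pi-lambda theorem is used twice: with a cylinder over [S1] held fixed it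
    extends independence to all of the block of [S2], and with an event of that
    block held fixed it extends independence to the block of [S1]. *)
Theorem block_indep S1 S2 A B : S1 `&` S2 = set0 ->
  block S1 A -> block S2 B -> P (A `&` B) = (P A * P B)%E.
Proof.
move=> S12.
have step S (C : set T) : measurable C ->
    (forall D, cylinder S D -> P (D `&` C) = (P D * P C)%E) ->
    forall D, block S D -> P (D `&` C) = (P D * P C)%E.
  move=> mC hC D bD.
  suff : block S `<=` [set A | measurable A /\ P (A `&` C) = (P A * P C)%E].
    by move=> /(_ _ bD)[].
  apply: lambda_system_subset => //.
  - exact: cylinderI.
  - exact: indep_lambda_system.
  - by move=> E cE /=; split; [exact: cylinder_measurable cE|exact: hC].
move=> bA bB.
apply: (step _ _ _ _ _ bA); first exact: block_measurable bB.
move=> D cD; rewrite setIC muleC; apply: (step _ _ _ _ _ bB).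
  exact: cylinder_measurable cD.
by move=> E cE; rewrite setIC muleC; exact: cylinder_indep cD cE.
Qed.

Lemma sub_block S1 S2 : S1 `<=` S2 -> block S1 `<=` block S2.
Proof.
move=> S12; apply: sub_smallest2r; first exact: smallest_sigma_algebra.
move=> A [J [E [uJ h ->]]].
by exists J, E; split=> // i /h[Si ?]; split=> //; exact: S12.
Qed.

Lemma block1 (S : set I) i A : S i -> F i A -> block S A.
Proof.
move=> Si FA; apply: sub_sigma_algebra; exists [:: i], (fun=> A); split=> //.
  by move=> k; rewrite inE => /eqP ->.
rewrite bigcap_seq big_seq1 //.
Qed.

End BlockIndependence.

Section SigmaAlgebraPredicates.
Context (T : Type) (G : set_system T).
Hypothesis sG : sigma_algebra setT G.

(** An inductive wrapper and not an abbreviation: membership in a generated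
    sigma-algebra unfolds to a product, which would otherwise be seen through
    when premises are counted and implicit arguments are computed. *)
Inductive event (Q : T -> Prop) : Prop := Event of G [set w | Q w].

Lemma event_set Q : event Q -> G [set w | Q w].
Proof. by case. Qed.

Lemma event_ext Q Q' : (forall w, Q w <-> Q' w) -> event Q -> event Q'.
Proof.
move=> h [GQ]; split; suff <- : [set w | Q w] = [set w | Q' w] by [].
by apply/seteqP; split=> w /h.
Qed.

Lemma event_not Q : event Q -> event (fun w => ~ Q w).
Proof. by case: sG => _ + _ [GQ] => /(_ _ GQ); rewrite setTD. Qed.

Lemma event_exn (Q : nat -> T -> Prop) :
  (forall n, event (Q n)) -> event (fun w => exists n, Q n w).
Proof.
case: sG => _ _ + eQ => /(_ (fun n => [set w | Q n w]) (fun n => event_set (eQ n))) h.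
split; suff <- : \bigcup_n [set w | Q n w] = [set w | exists n, Q n w] by [].
apply/seteqP; split=> w /=.
  by move=> [n _ Qn]; exists n.
by move=> [n Qn]; exists n.
Qed.

Lemma event_False : event (fun=> False).
Proof. 
case: sG => G0 _ _; split; suff <- : set0 = [set w : T | False] by [].
by apply/seteqP; split.
 Qed.

Lemma event_const (p : Prop) : event (fun=> p).
Proof.
have [hp|hp] := pselect p; last by apply: event_ext event_False => w; split.
by apply: event_ext (event_not event_False) => w; split=> // _ [].
Qed.

Lemma event_ex (K : countType) (Q : K -> T -> Prop) :
  (forall k, event (Q k)) -> event (fun w => exists k, Q k w).
Proof.
move=> eQ.
pose Q' n w := if unpickle n is Some k then Q k w else False.
apply: (@event_ext (fun w => exists n, Q' n w)).
  move=> w; split=> [[n]|[k Qk]].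
    by rewrite /Q'; case: (unpickle n) => // k Qk; exists k.
  by exists (pickle k); rewrite /Q' pickleK.
apply: event_exn => n; rewrite /Q'; case: (unpickle n) => [k|]; first exact: eQ.
exact: event_False.
Qed.

Lemma event_all (K : countType) (Q : K -> T -> Prop) :
  (forall k, event (Q k)) -> event (fun w => forall k, Q k w).
Proof.
move=> eQ; have /event_not : event (fun w => exists k, ~ Q k w).
  by apply: event_ex => k; exact: event_not.
apply: event_ext => w; split=> [h k|h [k]]; last by apply; exact: h.
by apply: contrapT => nQ; apply: h; exists k.
Qed.

Lemma event_or Q Q' : event Q -> event Q' -> event (fun w => Q w \/ Q' w).
Proof.
move=> e e'; apply: (@event_ext (fun w => exists b : bool, if b then Q w else Q' w)).
  move=> w; split=> [[[]]|[]]; [by left|by right|by exists true|by exists false].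
by apply: event_ex => -[].
Qed.

Lemma event_and Q Q' : event Q -> event Q' -> event (fun w => Q w /\ Q' w).
Proof.
move=> e e'; apply: (@event_ext (fun w => forall b : bool, if b then Q w else Q' w)).
  move=> w; split=> [h|[? ?] []//]; split; [exact: (h true)|exact: (h false)].
by apply: event_all => -[].
Qed.

Lemma event_imp Q Q' : event Q -> event Q' -> event (fun w => Q w -> Q' w).
Proof.
move=> e e'; have := event_or (event_not e) e'; apply: event_ext => w.
split=> [[?|?] ?//|h]; have [q|nq] := pselect (Q w); [right; exact: h|by left].
Qed.

(** The side condition [p] may be used to show that [Q] is an event, which
    restricts a bounded quantifier to the indices where that is true. *)
Lemma event_guard (p : Prop) (Q : T -> Prop) :
  (p -> event Q) -> event (fun w => p -> Q w).
Proof.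
move=> eQ; have [hp|np] := pselect p.
  by apply: event_ext (eQ hp) => w; split=> [//|]; exact.
by apply: event_ext (event_const True) => w; split.
Qed.

Lemma event_preimage (K : countType) (f : T -> K) :
  (forall k, event (fun w => f w = k)) -> forall C : K -> Prop,
  event (fun w => C (f w)).
Proof.
move=> ef C; apply: (@event_ext (fun w => exists k, f w = k /\ C k)).
  by move=> w; split=> [[k [<-]]//|Cf]; exists (f w).
by apply: event_ex => k; apply: event_and (ef k) (event_const _).
Qed.

End SigmaAlgebraPredicates.

(** * Reaching a given distance by a nearest-neighbour walk *)

(** Here [m] is the distance that separates the walk from its target, and a step
    [true] goes towards the target. The recursion is on the first step, because
    the first step is independent of the rest of the walk. *)
Fixpoint reach (c : nat -> bool) (t m : nat) : bool :=
  if m is m'.+1 then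
    if t is t'.+1 then
      reach (fun u => c u.+1) t' (if c 0%N then m' else m'.+2)
    else false
  else true.

Lemma reachS c t m : reach c t m -> reach c t.+1 m.
Proof.
elim: t c m => [|t IH] c [|m] //=.
by move=> /IH.
Qed.

Lemma reach_le c s t m : (s <= t)%N -> reach c s m -> reach c t m.
Proof.
move=> /subnK <-; elim: (t - s)%N => //= n IH /IH; exact: reachS.
Qed.

Definition height (c : nat -> bool) (l : nat) : int :=
  \sum_(u < l) (if c u then 1 else -1).

Lemma heightS c l :
  height c l.+1 = (if c 0%N then 1 else -1) + height (fun u => c u.+1) l.
Proof. by rewrite /height big_ord_recl. Qed.

Lemma reachP c m :
  (exists t, reach c t m) <-> (exists l, height c l = m%:Z).
Proof.
split=> [[t]|[l]].
  elim: t c m => [|t IH] c [|m] //=; try by exists 0%N; rewrite /height big_ord0.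
  move=> /IH[l hl]; exists l.+1; rewrite heightS {}hl.
  by case: (c 0%N); lia.
elim: l c m => [|l IH] c [|m]; try by exists 0%N.
  by rewrite /height big_ord0.
rewrite heightS => hl.
have /IH[t ht] : height (fun u => c u.+1) l = (if c 0%N then m else m.+2)%:Z.
  by move: hl; case: (c 0%N); lia.
by exists t.+1.
Qed.

Section HittingProbability.
Context (R : realType).
Implicit Types (q : R) (H : nat -> R).

(** The probability that a walk whose steps go towards its target with
    probability [q] covers the distance [m] within [t] steps. *)
Fixpoint hprob q (t m : nat) : R :=
  if m is m'.+1 then
    if t is t'.+1 then q * hprob q t' m' + (1 - q) * hprob q t' m'.+2
    else 0
  else 1.

Lemma hprob0 q t : hprob q t 0 = 1. Proof. by case: t. Qed.

Lemma hprob_itv q t m : 0 < q < 1 -> 0 <= hprob q t m <= 1.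
Proof.
move=> /andP[q0 q1].
elim: t m => [|t IH] [|m] //=; rewrite ?ler01 ?lexx//.
have /andP[a0 a1] := IH m; have /andP[b0 b1] := IH m.+2.
by apply/andP; split; nra.
Qed.

Lemma hprobS q t m : 0 < q < 1 -> hprob q t m <= hprob q t.+1 m.
Proof.
move=> q01; have /andP[q0 q1] := q01.
elim: t m => [|t IH] [|m] //; first by have /andP[] := hprob_itv 1 m.+1 q01.
have := IH m; have := IH m.+2.
rewrite [hprob q t.+1 m.+1]/= [hprob q t.+2 m.+1]/=.
by move=> h1 h2; apply: lerD; apply: ler_wpM2l => //; lra.
Qed.

(** The geometric sequence on the right solves the same recurrence and dominates
    the initial values. The bound is what selects the right solution of the
    recurrence in the limit when [q] is less than 1/2. *)
Lemma hprob_le q t m : 0 < q < 1 -> hprob q t m <= (q / (1 - q)) ^+ m.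
Proof.
move=> /andP[q0 q1]; set r := q / (1 - q).
have q1' : 1 - q != 0 by apply/eqP; lra.
have r0 : 0 <= r by apply: divr_ge0; lra.
elim: t m => [|t IH] [|m] //; first by rewrite exprn_ge0.
have h1 := IH m; have h2 := IH m.+2.
have -> : r ^+ m.+1 = q * r ^+ m + (1 - q) * r ^+ m.+2.
  by rewrite !exprS /r; field.
by rewrite /=; apply: lerD; apply: ler_wpM2l => //; lra.
Qed.

(** The successive differences of [H] form a geometric progression of ratio
    [q / (1 - q)]. *)
Lemma hitting_recurrence q H : 0 < q < 1 -> H 0%N = 1 ->
  (forall m, H m.+1 = q * H m + (1 - q) * H m.+2) ->
  forall m, H m = 1 + (H 1%N - 1) * \sum_(i < m) (q / (1 - q)) ^+ i.
Proof.
move=> /andP[q0 q1] H0 Hrec.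
have q1' : 1 - q != 0 by apply/eqP; lra.
have diff m : H m.+1 - H m = (q / (1 - q)) ^+ m * (H 1%N - 1).
  elim: m => [|m IH]; first by rewrite expr0 mul1r H0.
  rewrite exprS -mulrA -IH.
  have -> : H m.+2 = (H m.+1 - q * H m) / (1 - q) by rewrite (Hrec m); field.
  by field.
elim=> [|m IH]; first by rewrite big_ord0 mulr0 addr0.
rewrite big_ord_recr /= mulrDr addrA -IH.
by rewrite [_ * _ ^+ m]mulrC -diff addrC subrK.
Qed.

(** The ratio exceeds 1, so the sum of the first [k] powers is at least [k], and
    a nonzero first difference would make [H] unbounded. *)
Lemma hitting_recurrent q H : 1 / 2 < q < 1 -> H 0%N = 1 ->
  (forall m, 0 <= H m <= 1) ->
  (forall m, H m.+1 = q * H m + (1 - q) * H m.+2) ->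
  forall m, H m = 1.
Proof.
move=> /andP[q0 q1] H0 H01 Hrec m.
have HE := hitting_recurrence _ H0 Hrec.
set D := 1 - H 1%N.
have D0 : 0 <= D by have := H01 1%N; rewrite /D; lra.
suff DE : D = 0 by rewrite HE; [rewrite -[H 1%N - 1]opprB -/D DE; ring|lra].
apply/eqP; rewrite eq_le D0 andbT leNgt; apply/negP => Dp.
(* Some k exceeds 1 / D, and D times the sum of k powers is at most 1 - H k. *)
pose k := (Num.truncn (D^-1)).+1.
have kD : 1 < D * k%:R.
  have : 0 <= D^-1 by rewrite invr_ge0.
  by rewrite mulrC -ltr_pdivrMr// div1r /k => /truncn_itv /andP[].
have : k%:R <= \sum_(i < k) (q / (1 - q)) ^+ i.
  rewrite -[k in k%:R]card_ord -sum1_card natr_sum; apply: ler_sum => i _.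
  by apply: exprn_ege1; rewrite ler_pdivlMr; lra.
have := H01 k; rewrite HE; last lra.
rewrite -[H 1%N - 1]opprB -/D => /andP[h _] h2.
have : D * k%:R <= D * \sum_(i < k) (q / (1 - q)) ^+ i by apply: ler_wpM2l.
by lra.
Qed.

(** The ratio is less than 1, so [H] converges, and nonnegativity of its limit
    is the lower bound on [H 1] that matches the assumed upper bound. *)
Lemma hitting_transient q H : 0 < q < 1 / 2 -> H 0%N = 1 ->
  (forall m, 0 <= H m) -> (H 1%N <= q / (1 - q)) ->
  (forall m, H m.+1 = q * H m + (1 - q) * H m.+2) ->
  forall m, H m = (q / (1 - q)) ^+ m.
Proof.
move=> /andP[q0 q1] H0 Hge Hle Hrec m.
have HE := hitting_recurrence _ H0 Hrec.
set r := q / (1 - q).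
have r0 : 0 <= r by apply: divr_ge0; lra.
have r1 : r < 1 by rewrite ltr_pdivrMr; lra.
have geo k : (1 - r) * \sum_(i < k) r ^+ i = 1 - r ^+ k.
  by rewrite -[1 - r]opprB mulNr -subrX1 opprB.
suff H1 : H 1%N = r.
  by rewrite HE; [rewrite -/r H1 -opprB mulNr geo; ring|lra].
apply/eqP; rewrite eq_le Hle /= -subr_le0.
have c : (1 - H 1%N) * (1 - r ^+ k) @[k --> \oo] --> (1 - H 1%N) * (1 - 0).
  apply: cvgMr; apply: cvgB; first exact: cvg_cst.
  by apply: cvg_expr; rewrite ger0_norm.
have : (1 - H 1%N) * (1 - 0) <= 1 - r.
  rewrite -(cvg_lim _ c)//; apply: limr_le; first by apply/cvg_ex; eexists; exact: c.
  near=> k; have := Hge k; rewrite HE -/r; last lra.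
  move=> h; have : 0 <= (1 - r) * (1 + (H 1%N - 1) * \sum_(i < k) r ^+ i).
    by apply: mulr_ge0 => //; lra.
  rewrite mulrDr mulr1 mulrCA geo; lra.
by lra.
Unshelve. all: by end_near. Qed.

Lemma hprob_is_cvg q m : 0 < q < 1 -> cvgn (fun t => hprob q t m).
Proof.
move=> q01; apply: nondecreasing_is_cvgn.
  by apply/nondecreasing_seqP => t; exact: hprobS.
by exists 1 => _ [t _ <-]; have /andP[] := hprob_itv t m q01.
Qed.

(** The probability of ever covering the distance [m]. *)
Definition hlim q m : R := limn (fun t => hprob q t m).

Lemma hlim_cvg q m : 0 < q < 1 -> (hprob q t m @[t --> \oo]) --> hlim q m.
Proof. exact: hprob_is_cvg. Qed.

Lemma hlim0 q : hlim q 0 = 1.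
Proof. by rewrite /hlim; under eq_fun do rewrite hprob0; rewrite lim_cst. Qed.

Lemma hlim_itv q m : 0 < q < 1 -> 0 <= hlim q m <= 1.
Proof.
move=> q01; apply/andP; split.
  apply: limr_ge; first exact: hprob_is_cvg.
  by near=> t; have /andP[] := hprob_itv t m q01.
apply: limr_le; first exact: hprob_is_cvg.
by near=> t; have /andP[] := hprob_itv t m q01.
Unshelve. all: by end_near. Qed.

Lemma hlim_rec q m : 0 < q < 1 ->
  hlim q m.+1 = q * hlim q m + (1 - q) * hlim q m.+2.
Proof.
move=> q01.
have c1 : hprob q t.+1 m.+1 @[t --> \oo] --> hlim q m.+1.
  by have := @hlim_cvg q m.+1 q01; rewrite -cvg_shiftS.
have c2 : hprob q t.+1 m.+1 @[t --> \oo] -->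
    q * hlim q m + (1 - q) * hlim q m.+2.
  by apply: cvgD; apply: cvgMr; exact: hlim_cvg.
by rewrite -(cvg_lim _ c1)// (cvg_lim _ c2).
Qed.

Lemma hlim_recurrent q m : 1 / 2 < q < 1 -> hlim q m = 1.
Proof.
move=> q01; have q01' : 0 < q < 1 by lra.
apply: (hitting_recurrent q01 (hlim0 q)) => k; first exact: hlim_itv.
exact: hlim_rec.
Qed.

Lemma hlim_transient q m : 0 < q < 1 / 2 -> hlim q m = (q / (1 - q)) ^+ m.
Proof.
move=> q01; have q01' : 0 < q < 1 by lra.
apply: (hitting_transient q01 (hlim0 q)) => [k||k].
- by have /andP[] := hlim_itv k q01'.
- apply: limr_le; first exact: hprob_is_cvg.
  by near=> t; rewrite -[leRHS]expr1; exact: hprob_le.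
- exact: hlim_rec.
Unshelve. all: by end_near. Qed.

End HittingProbability.

(** * Independent trials *)

Section IndependentTrials.
Context d (T : measurableType d) (R : realType) (P : probability T R).
Context (I : choiceType) (F : I -> set_system T).
Hypothesis Fm : forall i, F i `<=` measurable.
Hypothesis FI : forall i, setI_closed (F i).
Hypothesis Findep : mutual_indep_systems P F.

Let sb S : sigma_algebra setT (block F S) := block_sigma_algebra F S.

Lemma event_block_sub (S1 S2 : set I) (Q : T -> Prop) : S1 `<=` S2 ->
  event (block F S1) Q -> event (block F S2) Q.
Proof. by move=> S12 [bQ]; split; exact: sub_block bQ. Qed.

Lemma event_block_measurable (S : set I) (Q : T -> Prop) :
  event (block F S) Q -> measurable [set w | Q w].
Proof. by move=> [bQ]; exact: block_measurable bQ. Qed.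

Lemma block_indep_prod (S : nat -> set I) (Q : nat -> T -> Prop)
    (x : nat -> R) (m n : nat) :
  trivIset setT S -> (forall i, event (block F (S i)) (Q i)) ->
  (forall i, (m <= i < n)%N -> P [set w | Q i w] = (x i)%:E) ->
  P [set w | forall i, (m <= i < n)%N -> Q i w] = (\prod_(m <= i < n) x i)%:E.
Proof.
move=> tS eQ; elim: n => [_|n IH PQ].
  rewrite big_geq// -(@probability_setT _ _ _ P); congr (P _).
  by apply/seteqP; split=> // w _ i; rewrite ltn0 andbF.
have [nm|mn] := ltnP n m.
  rewrite big_geq// -(@probability_setT _ _ _ P); congr (P _).
  apply/seteqP; split=> // w _ i /andP[mi]; rewrite ltnS => ni.
  by have := leq_trans mi ni; rewrite leqNgt nm.
rewrite big_nat_recr//= EFinM -IH; last first.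
  by move=> i /andP[mi ni]; apply: PQ; rewrite mi ltnW.
rewrite -PQ ?mn ?leqnn//.
rewrite -(@block_indep _ _ _ P _ F Fm FI Findep (\bigcup_(i in `I_n) S i) (S n)).
- congr (P _); apply/seteqP; split=> w /=.
    move=> h; split=> [i /andP[mi ni]|]; apply: h; rewrite ?mi ?mn ?leqnn//=.
    exact: ltnW.
  move=> [h hn] i /andP[mi]; rewrite ltnS leq_eqVlt => /orP[/eqP -> //|ni].
  by apply: h; rewrite mi.
- rewrite setI_bigcupl bigcup0// => i /= ni.
  by move/trivIsetP : tS; apply => //; rewrite ltn_eqF.
- apply: event_set; apply: (event_all (sb _)) => i.
  apply: (event_guard (sb _)) => /andP[mi ni].
  by apply: (event_block_sub _ (eQ i)) => u Su; exists i.
- exact: event_set.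
Qed.

Section Trials.
Context (c : nat -> T -> bool) (e : nat -> I) (q : R).
Hypothesis einj : injective e.
Hypothesis ce : forall u, event (block F [set e u]) (fun w => c u w).
Hypothesis Pc : forall u, P [set w | c u w] = q%:E.

Lemma reach_event k t m :
  event (block F (e @` [set v | (k <= v)%N]))
    (fun w => reach (fun u => c (k + u)%N w) t m).
Proof.
elim: t k m => [|t IH] k [|m].
- exact: (event_const (sb _) true).
- exact: (event_const (sb _) false).
- exact: (event_const (sb _) true).
have ek : event (block F (e @` [set v | (k <= v)%N])) (fun w => c k w).
  by apply: (event_block_sub _ (ce k)) => _ ->; exists k => /=.
have IH' m' : event (block F (e @` [set v | (k <= v)%N]))
    (fun w => reach (fun u => c (k + u.+1)%N w) t m').
  have shift w : (fun u => c (k + u.+1)%N w) = (fun u => c (k.+1 + u)%N w).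
    by apply/funext => u; rewrite addSnnS.
  apply: (@event_ext _ _ (fun w => reach (fun u => c (k.+1 + u)%N w) t m')).
    by move=> w; rewrite shift.
  apply: (event_block_sub _ (IH k.+1 m')) => _ [v /= kv <-].
  by exists v => //=; exact: ltnW.
apply: event_ext (event_or (sb _) (event_and (sb _) ek (IH' m))
  (event_and (sb _) (event_not (sb _) ek) (IH' m.+2))) => w /=.
rewrite addn0; case: (c k w); split.
- by move=> [[]|[]].
- by left.
- by move=> [[]|[]].
- by right.
Qed.

(** First-step analysis: step [k] is independent of the walk that starts after
    it, and the law of that walk does not depend on [k]. *)
Lemma reach_prob k t m : 
  P [set w | reach (fun u => c (k + u)%N w) t m] = (hprob q t m)%:E.
Proof.
have P1 : P [set w | true] = 1%E.
  by rewrite (_ : [set w | true] = setT) ?probability_setT//; apply/seteqP; split.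
elim: t k m => [|t IH] k [|m] //=.
  by rewrite (_ : [set _ | _] = set0) ?measure0//; apply/seteqP; split.
have ek := ce k.
pose S1 : set I := [set e k]; pose S2 : set I := e @` [set v | (k.+1 <= v)%N].
have S12 : S1 `&` S2 = set0.
  apply/seteqP; split=> // _ [/= -> [v /= kv /einj vk]].
  by rewrite vk ltnn in kv.
have E m' : event (block F S2) (fun w => reach (fun u => c (k.+1 + u)%N w) t m').
  exact: reach_event.
have -> : [set w | reach (fun u => c (k + u.+1)%N w) t (if c (k + 0)%N w then m else m.+2)] =
   ([set w | c k w] `&` [set w | reach (fun u => c (k.+1 + u)%N w) t m]) `|`
   ([set w | ~ c k w] `&` [set w | reach (fun u => c (k.+1 + u)%N w) t m.+2]).
  apply/seteqP; split=> w /=; rewrite addn0.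
    rewrite (_ : (fun u => c (k + u.+1)%N w) = (fun u => c (k.+1 + u)%N w)).
      by case: (c k w); [left|right].
    by apply/funext => u; rewrite addSnnS.
  rewrite (_ : (fun u => c (k + u.+1)%N w) = (fun u => c (k.+1 + u)%N w)).
    by case: (c k w) => -[[]|[]].
  by apply/funext => u; rewrite addSnnS.
have nek : event (block F S1) (fun w => ~ c k w) by exact: (event_not (sb _)).
have mk := event_block_measurable ek; have mnk := event_block_measurable nek.
have mE m' := event_block_measurable (E m').
transitivity (P ([set w | c k w] `&` [set w | reach (fun u => c (k.+1 + u)%N w) t m]) +
   P ([set w | ~ c k w] `&` [set w | reach (fun u => c (k.+1 + u)%N w) t m.+2]))%E.
  apply: measureU; [exact: measurableI|exact: measurableI|].
  by apply/seteqP; split=> // w /= [[? _] [? _]].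
have indep m' C := @block_indep _ _ _ P _ F Fm FI Findep S1 S2 C _ S12 ^~ (event_set (E m')).
rewrite !indep ?IH ?Pc//; [|exact: event_set nek|exact: event_set ek].
have -> : P [set w | ~ c k w] = (1 - q)%:E.
  rewrite (_ : [set w | ~ c k w] = ~` [set w | c k w])//.
  by rewrite probability_setC// Pc.
by [].
Qed.

Lemma hit_event m :
  event (block F (range e)) (fun w => exists t, reach (c ^~ w) t m).
Proof.
apply: (event_exn (sb _)) => t; apply: (event_block_sub _ (reach_event 0 t m)).
by move=> _ [v _ <-]; exists v.
Qed.

(** The events of reaching the target within [t] steps increase with [t]. *)
Lemma hit_prob m : 0 < q < 1 ->
  P [set w | exists t, reach (c ^~ w) t m] = (hlim q m)%:E.
Proof.
move=> q01.
have -> : [set w | exists t, reach (c ^~ w) t m] =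
    \bigcup_t [set w | reach (c ^~ w) t m].
  by apply/seteqP; split=> w [t]; exists t.
have mt t : measurable [set w | reach (c ^~ w) t m].
  exact: event_block_measurable (reach_event 0 t m).
have c1 : P [set w | reach (c ^~ w) t m] @[t --> \oo] -->
    P (\bigcup_t [set w | reach (c ^~ w) t m]).
  apply: nondecreasing_cvg_mu => //.
    by apply: bigcup_measurable.
  move=> s t st; apply/subsetPset => w; exact: reach_le.
rewrite -(cvg_lim _ c1)//.
under eq_fun do rewrite (reach_prob 0).
apply/cvg_lim => //; apply: cvg_EFin; first by near=> t.
exact: hlim_cvg.
Unshelve. all: by end_near. Qed.

End Trials.

End IndependentTrials.

(** * Probability generating functions *)

Section GeneratingFunction.
Context d (T : measurableType d) (R : realType) (P : probability T R).
Implicit Types (X Y : {RV P >-> nat}) (s : R).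

Lemma measurable_count X (C : set nat) : measurable [set w | C (X w)].
Proof.
rewrite (_ : [set w | C (X w)] = setT `&` X @^-1` C); last by rewrite setTI.
exact: (@measurable_funPT _ _ _ _ X).
Qed.

Lemma measurable_fun_count X (f : nat -> R) :
  measurable_fun setT (fun w => (f (X w))%:E).
Proof.
have mf : measurable_fun setT (fun n : nat => (f n)%:E) by [].
exact: (measurableT_comp mf).
Qed.

(** The generating function as an extended real, which is what integration
    theorems speak about; [pgfE] identifies it with [pgf]. *)
Definition epgf X s : \bar R := (\int[P]_w (s ^+ X w)%:E)%E.

(** The integral is split over the values of [X]. *)
Lemma epgf_series X s : 0 <= s ->
  epgf X s = (\sum_(k <oo) ((s ^+ k)%:E * P [set w | X w = k]))%E.
Proof.
move=> s0.
have UT : \bigcup_k [set w | X w = k] = setT.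
  by apply/seteqP; split=> // w _; exists (X w).
rewrite /epgf -[in LHS]UT ge0_integral_bigcup.
- apply: eq_eseriesr => k _.
  have mk : measurable [set w | X w = k] := measurable_count X [set k].
  rewrite -integral_cst//; apply: eq_integral => w.
  by rewrite inE /= => ->.
- by move=> k; exact: (measurable_count X [set k]).
- by rewrite UT; exact: (measurable_fun_count X (fun n => s ^+ n)).
- by move=> w _; rewrite lee_fin exprn_ge0.
- by move=> i j _ _ [w [/= <- <-]].
Qed.

(** Since [1 - s ^+ x] is the sum of [(1 - s) * s ^+ l] over [l < x], the
    complement of the generating function is a nonnegative combination of the
    tails of [X]. *)
Lemma epgf_tail X s : 0 <= s <= 1 ->
  (epgf X s + \sum_(l <oo) (((1 - s) * s ^+ l)%:E * P [set w | l < X w]%N) = 1)%E.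
Proof.
move=> /andP[s0 s1].
have gE x : (\sum_(l <oo) ((1 - s) * s ^+ l * (l < x)%:R)%:E = (1 - s ^+ x)%:E)%E.
  rewrite (@nneseries_split _ _ 0%N x)/= ?add0n; last first.
    by move=> l _; rewrite lee_fin !mulr_ge0 ?exprn_ge0 ?subr_ge0.
  rewrite [X in (_ + X)%E]eseries0 ?adde0; last first.
    by move=> l xl _; rewrite ltnNge xl mulr0.
  rewrite sumEFin; congr EFin.
  rewrite -[1 - s ^+ x]opprB subrX1 -mulNr opprB big_mkord mulr_sumr.
  by apply: eq_bigr => i _; rewrite ltn_ord mulr1.
have -> : (\sum_(l <oo) (((1 - s) * s ^+ l)%:E * P [set w | l < X w]%N) =
    \int[P]_w (1 - s ^+ X w)%:E)%E.
  transitivity (\int[P]_w (\sum_(l <oo) ((1 - s) * s ^+ l * (l < X w)%:R)%:E))%E; last first.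
    by apply: eq_integral => w _; exact: gE.
  rewrite integral_nneseries//; last 2 first.
  - move=> l; exact: (measurable_fun_count X (fun n => (1 - s) * s ^+ l * (l < n)%:R)).
  - by move=> l w _; rewrite lee_fin !mulr_ge0 ?exprn_ge0 ?subr_ge0.
  apply: eq_eseriesr => l _.
  have ml : measurable [set w | (l < X w)%N] := measurable_count X [set n | (l < n)%N].
  under [RHS]eq_integral do rewrite EFinM.
  rewrite ge0_integralZl_EFin//.
  - congr (_ * _)%E; rewrite -[in LHS](setIT [set w | _]) -integral_indic//.
    apply: eq_integral => w _; rewrite indicE.
    by have -> : (w \in [set w | (l < X w)%N]) = (l < X w)%N by apply/idP/idP; rewrite inE.
  - exact: (measurable_fun_count X (fun n => (l < n)%:R)).
  - by rewrite mulr_ge0 ?exprn_ge0 ?subr_ge0.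
rewrite /epgf -ge0_integralD//.
- rewrite -(@probability_setT _ _ _ P) -[RHS]mul1e -integral_cst//.
  by apply: eq_integral => w _; rewrite -EFinD addrC subrK.
- by move=> w _; rewrite lee_fin exprn_ge0.
- exact: (measurable_fun_count X (fun n => s ^+ n)).
- by move=> w _; rewrite lee_fin subr_ge0 exprn_ile1.
- exact: (measurable_fun_count X (fun n => 1 - s ^+ n)).
Qed.

Lemma epgf_ge0 X s : 0 <= s -> (0 <= epgf X s)%E.
Proof. by move=> s0; apply: integral_ge0 => w _; rewrite lee_fin exprn_ge0. Qed.

Lemma epgf_le1 X s : 0 <= s <= 1 -> (epgf X s <= 1)%E.
Proof.
move=> s01; rewrite -(epgf_tail X s01) leeDl//; apply: nneseries_ge0 => l _ _.
have /andP[s0 s1] := s01.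
by rewrite mule_ge0// lee_fin mulr_ge0 ?exprn_ge0 ?subr_ge0.
Qed.

Lemma pgfE X s : 0 <= s <= 1 -> (pgf P X s)%:E = epgf X s.
Proof.
move=> s01; have /andP[s0 _] := s01; rewrite /pgf expectation.unlock fineK//.
rewrite ge0_fin_numE; last exact: epgf_ge0.
by rewrite (le_lt_trans (epgf_le1 X s01)) ?ltry.
Qed.

Lemma pgf_itv X s : 0 <= s <= 1 -> 0 <= pgf P X s <= 1.
Proof.
move=> s01; rewrite -!lee_fin pgfE// epgf_le1//.
by case/andP: s01 => s0 _; rewrite epgf_ge0.
Qed.

Lemma pgf_le X s s' : 0 <= s -> s <= s' -> s' <= 1 -> pgf P X s <= pgf P X s'.
Proof.
move=> s0 ss' s1; have s'0 := le_trans s0 ss'.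
rewrite -lee_fin !pgfE ?s0 ?s'0 ?s1 ?(le_trans ss')//.
apply: ge0_le_integral => //.
- by move=> w _; rewrite lee_fin exprn_ge0.
- exact: (measurable_fun_count X (fun n => s ^+ n)).
- exact: (measurable_fun_count X (fun n => s' ^+ n)).
- by move=> w _; rewrite lee_fin lerXn2r.
Qed.

(** Larger tails leave less in the identity of [epgf_tail]. *)
Lemma pgf_dominance X Y s : 0 <= s <= 1 ->
  (forall k, P [set w | k <= X w]%N <= P [set w | k <= Y w]%N)%E ->
  pgf P Y s <= pgf P X s.
Proof.
move=> s01 XY; have /andP[s0 s1] := s01.
pose tail (Z : T -> nat) := (\sum_(l <oo) (((1 - s) * s ^+ l)%:E * P [set w | l < Z w]%N))%E.
have le_tail : (tail X <= tail Y)%E.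
  apply: lee_nneseries => [l _ _|l _].
    by rewrite mule_ge0// lee_fin mulr_ge0 ?exprn_ge0 ?subr_ge0.
  by apply: lee_wpmul2l; [rewrite lee_fin mulr_ge0 ?exprn_ge0 ?subr_ge0|exact: XY].
have le_of_sum (a b : R) (u v : \bar R) :
    (u <= v)%E -> (a%:E + u = 1)%E -> (b%:E + v = 1)%E -> b <= a.
  case: u v => [u| |] [v| |]//; rewrite lee_fin -!EFinD => uv [ea] [eb].
  by lra.
by apply: (le_of_sum _ _ _ _ le_tail); rewrite pgfE//; exact: epgf_tail.
Qed.

End GeneratingFunction.

(** * Which sites wake up: the dynamics of one outcome *)

Section Dynamics.
Context (T : Type) (X : nat -> T -> nat) (L : nat -> nat -> nat -> T -> bool).

(** These predicates speak about the whole trajectory of a frog, whether or not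
    it is ever activated: frog [(j, i)] visits [j + m], resp. [j - m]. *)
Definition up j i m (w : T) := exists t, reach (fun u => ~~ L j i u w) t m.
Definition down j i m (w : T) := exists t, reach (fun u => L j i u w) t m.
Definition silent j m w := forall i, (i < X j w)%N -> ~ up j i m w.
Definition quiet m n w := forall j, (m <= j < n)%N -> silent j (n - j) w.
(** When the frogs of all the sites below [n] are made to walk, none of them
    visits [n]. The origin is treated apart because its frog is not counted by
    [X]. *)
Definition gap n w := ~ up 0 0 n w /\ quiet 1 n w.

Lemma walkE j i k w : walk L j i k w = j%:Z + height (fun u => ~~ L j i u w) k.
Proof. by congr (_ + _); apply: eq_bigr => u _; case: (L j i u w). Qed.

Lemma upP j i m w : up j i m w <-> exists k, walk L j i k w = j%:Z + m%:Z.
Proof.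
rewrite /up reachP; split=> -[k hk]; exists k.
  by rewrite walkE hk.
by move: hk; rewrite walkE => /addrI.
Qed.

Lemma downP j i m w : down j i m w <-> exists k, walk L j i k w = j%:Z - m%:Z.
Proof.
have opp k : height (fun u => L j i u w) k = - height (fun u => ~~ L j i u w) k.
  by rewrite /height -sumrN; apply: eq_bigr => u _; case: (L j i u w).
rewrite /down reachP; split=> -[k hk]; exists k.
  by rewrite walkE -hk opp opprK.
by move: hk; rewrite walkE => /addrI hk; rewrite opp hk opprK.
Qed.

(** Steps have length one. *)
Lemma height_ivt c k (m : nat) : m%:Z <= height c k ->
  exists k', height c k' = m%:Z.
Proof.
elim: k => [|k IH].
  by rewrite {1}/height big_ord0 => h; exists 0%N; rewrite /height big_ord0; lia.
have [/IH //|lt] := lerP m%:Z (height c k).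
move=> h; exists k.+1; move: h; rewrite /height big_ord_recr /= -/(height c k).
by case: (c k); lia.
Qed.

Lemma gapP n w : (0 < n)%N -> gap n w <->
  forall j i, (j < n)%N -> (i < frogs_at X j w)%N -> ~ up j i (n - j) w.
Proof.
move=> n0; split=> [[g0 g] [|j] i jn|h].
- by rewrite /= ltnS leqn0 => /eqP ->; rewrite subn0.
- by move=> iX; exact: (g j.+1).
- split=> [|j /andP[j0 jn] i iX]; first by have := h 0 0; rewrite subn0; apply.
  by apply: h => //; case: j j0 {jn} iX.
Qed.

Lemma age_exact n j a w : age X L w n j = Some a ->
  exists n0, age X L w n0 j = Some 0%N.
Proof.
elim: n a => [|n IH] a /=; first by case: ifP => // j0 _; exists 0%N; rewrite /= j0.
case E : (age X L w n j) => [a'|]; first by move=> _; exact: IH E.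
by move=> h; exists n.+1; rewrite /= E; move: h; case: ifP.
Qed.

Lemma age_add n s j a w : age X L w n j = Some a ->
  age X L w (n + s) j = Some (a + s)%N.
Proof.
move=> h; elim: s => [|s IH]; first by rewrite !addn0.
by rewrite addnS /= IH addnS.
Qed.

(** By induction on time, only the frogs below [m] can be active, and to land on
    a site at or above [m] one of them would have to visit [m] itself. *)
Lemma gap_age m w : (0 < m)%N -> gap m w ->
  forall n j, (m <= j)%N -> age X L w n j = None.
Proof.
move=> m0 /(gapP _ m0) g; elim=> [|n IH] j mj /=.
  by case: eqP => // j0; move: mj; rewrite j0 leqNgt m0.
rewrite IH//; case: ifPn => // /asboolP[x [i [a [iX ax wj]]]].
have xm : (x < m)%N by rewrite ltnNge; apply/negP => /IH; rewrite ax.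
exfalso; apply: (g x i xm iX).
rewrite /up reachP; apply: (@height_ivt _ a.+1).
by move: wj; rewrite walkE; lia.
Qed.

Definition woken j w := exists n, age X L w n j = Some 0%N.

(** Strong induction on the site: as it is not a gap, some frog of a lower site,
    which is woken by induction, visits it. *)
Lemma no_gap_woken w : (forall n, (0 < n)%N -> ~ gap n w) ->
  forall j, woken j w.
Proof.
move=> ng; elim/ltn_ind => -[_|j IH]; first by exists 0%N.
have := ng j.+1 isT; rewrite gapP// => /existsNP[x /existsNP[i]].
move=> /not_implyP[xj /not_implyP[iX /contrapT]].
have [n0 age0] := IH _ xj.
move=> /upP[[|k]].
  by rewrite /walk big_ord0; lia.
have ->: x%:Z + (j.+1 - x)%N%:Z = j.+1%:Z by lia.
move=> wk; have agek := age_add k age0.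
case E : (age X L w (n0 + k) j.+1) => [a|]; first exact: age_exact E.
exists (n0 + k).+1; rewrite /= E; case: asboolP => // -[].
by exists x, i, k.
Qed.

Lemma woken_hits j i w : woken j w -> (i < frogs_at X j w)%N -> down j i j w ->
  hits_origin X L w (j, i).
Proof.
move=> [n hn] iX /downP[k hk]; split=> //; exists (n + k)%N, k; split.
  exact: age_add hn.
by rewrite hk subrr.
Qed.

Lemma gap_finite m w : (0 < m)%N -> gap m w ->
  finite_set [set f | hits_origin X L w f].
Proof.
move=> m0 g.
pose N := (\max_(j < m) frogs_at X j w)%N.
apply: (@sub_finite_set _ _ (`I_m `*` `I_N)); last first.
  by apply: finite_setX; exact: finite_II.
move=> [j i] [/= iX [n [a [ha _]]]].
have jm : (j < m)%N.
  by rewrite ltnNge; apply/negP => mj; move: ha; rewrite (gap_age m0 g).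
split=> //=; apply: leq_trans iX _.
exact: (leq_bigmax (Ordinal jm) : (frogs_at X (Ordinal jm) w <= N)%N).
Qed.

(** All sites wake up, so every frog of the model hits the origin. If these were
    finitely many, their trajectories would have a common upper bound, and a site
    beyond that bound would be a gap. *)
Lemma no_gap_infinite w : (forall n, (0 < n)%N -> ~ gap n w) ->
  (forall j i, down j i j w) -> (forall j i, exists m, ~ up j i m w) ->
  infinite_set [set f | hits_origin X L w f].
Proof.
move=> ng dn bnd fin.
have [N hN] : exists N, forall j i, (i < frogs_at X j w)%N -> (j < N)%N /\ (i < N)%N.
  have hit j i : (i < frogs_at X j w)%N -> hits_origin X L w (j, i).
    by move=> iX; apply: woken_hits => //; exact: no_gap_woken.
  have /finite_seqP[s hs] := fin.
  exists (\max_(f <- s) (f.1 + f.2)).+1 => j i /hit.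
  rewrite -[hits_origin _ _ _ _]/([set f | hits_origin X L w f] (j, i)) hs /= => js.
  have /= := leq_bigmax_seq (F := fun f : nat * nat => (f.1 + f.2)%N) (P := xpredT) (j, i) js isT.
  by lia.
have mono c m m' : (m <= m')%N -> (exists t, reach c t m') -> exists t, reach c t m.
  rewrite !reachP => mm' [l hl]; apply: (@height_ivt _ l); rewrite hl; lia.
have /choice[b hb] : forall f : nat * nat, exists m, ~ up f.1 f.2 m w by move=> f; exact: bnd.
(* M is larger than every level that a frog of the model can reach. *)
pose M := (\max_(j < N) \max_(i < N) (j + b (val j, val i)))%N.+1.
have := ng M isT; rewrite gapP//; apply => j i jM iX.
have [jN iN] := hN _ _ iX.
apply: contra_not (hb (j, i)) => /=; apply: mono.
have : (j + b (j, i) <= M)%N.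
  apply: leqW; apply: leq_trans (leq_bigmax (Ordinal jN)).
  exact: (leq_bigmax (Ordinal iN)).
by lia.
Qed.

End Dynamics.

(** * The laws of the events of the frog model *)

Section FrogEvents.
Context d (T : measurableType d) (R : realType) (P : probability T R).
Context (X : nat -> {RV P >-> nat}) (L : nat -> nat -> nat -> {RV P >-> bool}).
Context (p : nat -> R).
Hypothesis p_range : forall j, 1 / 2 < p j < 1.
Hypothesis L_law : forall j i k, P [set w | L j i k w = true] = (p j)%:E.
Hypothesis indep : frog_independence X L.

Local Notation up := (up L).
Local Notation down := (down L).
Local Notation silent := (silent X L).
Local Notation quiet := (quiet X L).
Local Notation gap := (gap X L).

Definition coord_system (u : nat + nat * nat * nat) : set_system T :=
  match u with
  | inl j => sigma_of_RV (X j.+1)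
  | inr (j, i, k) => sigma_of_RV (L j i k)
  end.

(** The coordinates are the counts and the steps; [inl j] is the count of site
    [j.+1], as in [frog_independence]. *)
Definition site (u : nat + nat * nat * nat) : nat :=
  match u with inl j => j.+1 | inr (j, _, _) => j end.

Definition on_sites (D : set nat) : set_system T :=
  block coord_system (site @^-1` D).

Lemma coord_measurable u : coord_system u `<=` measurable.
Proof.
case: u => [j|[[j i] k]] A /= [B mB <-].
  exact: (@measurable_funPT _ _ _ _ (X j.+1)).
exact: (@measurable_funPT _ _ _ _ (L j i k)).
Qed.

Lemma coord_setI_closed u : setI_closed (coord_system u).
Proof.
have rvI d' (T' : measurableType d') (Y : {RV P >-> T'}) :
    setI_closed (sigma_of_RV Y).
  move=> A B [A' mA <-] [B' mB <-]; exists (A' `&` B'); first exact: measurableI.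
  by rewrite preimage_setI setIACA setIid.
by case: u => [j|[[j i] k]]; exact: rvI.
Qed.

Let indepF : mutual_indep_systems P coord_system := indep.
Let blockI := block_indep coord_measurable coord_setI_closed indepF.
Let sb S : sigma_algebra setT (block coord_system S) :=
  block_sigma_algebra coord_system S.
Let ss D : sigma_algebra setT (on_sites D) := sb (site @^-1` D).

Lemma on_sites_sub (D E : set nat) (Q : T -> Prop) : D `<=` E ->
  event (on_sites D) Q -> event (on_sites E) Q.
Proof. by move=> DE; apply: event_block_sub => u; exact: DE. Qed.

Lemma on_sites_measurable D (Q : T -> Prop) :
  event (on_sites D) Q -> measurable [set w | Q w].
Proof. exact: (event_block_measurable coord_measurable). Qed.

Lemma on_sites_indep D E (Q Q' : T -> Prop) : D `&` E = set0 ->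
  event (on_sites D) Q -> event (on_sites E) Q' ->
  P [set w | Q w /\ Q' w] = (P [set w | Q w] * P [set w | Q' w])%E.
Proof.
move=> DE eQ eQ'; apply: (blockI _ (event_set eQ) (event_set eQ')).
by rewrite -preimage_setI DE preimage_set0.
Qed.

Lemma step_event j i k : event (block coord_system [set inr (j, i, k)])
  (fun w => L j i k w).
Proof.
split; apply: (@block1 _ _ _ _ _ (inr (j, i, k))) => //=.
exists [set true] => //; rewrite setTI; apply/seteqP; split=> w /=; by case: (L j i k w).
Qed.

Lemma count_event j k : (0 < j)%N ->
  event (block coord_system [set inl j.-1]) (fun w => X j w = k).
Proof.
case: j => // j _; split; apply: (@block1 _ _ _ _ _ (inl j)) => //=.
by exists [set k] => //; rewrite setTI.
Qed.


Definition steps j i : set (nat + nat * nat * nat) := range (fun k => inr (j, i, k)).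

Lemma step_inj j i :
  injective (fun k => inr (j, i, k) : nat + nat * nat * nat).
Proof. by move=> k l []. Qed.

Lemma right_step_event j i k : event (block coord_system [set inr (j, i, k)])
  (fun w => ~~ L j i k w).
Proof.
apply: event_ext (event_not (sb _) (step_event j i k)) => w.
by split=> /negP.
Qed.

Lemma right_step_prob j i k : P [set w | ~~ L j i k w] = (1 - p j)%:E.
Proof.
rewrite (_ : [set w | _] = ~` [set w | L j i k w = true]); last first.
  by apply/seteqP; split=> w /negP.
rewrite probability_setC ?L_law//.
exact: (event_block_measurable coord_measurable (step_event j i k)).
Qed.

Lemma up_event j i m : event (block coord_system (steps j i)) (up j i m).
Proof.
exact: (hit_event (c := fun u w => ~~ L j i u w) (right_step_event j i)).
Qed.

Lemma down_event j i m : event (block coord_system (steps j i)) (down j i m).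
Proof. exact: (hit_event (c := fun u w => L j i u w) (step_event j i)). Qed.

Definition ratio j := (1 - p j) / p j.

Lemma ratio_itv j : 0 < ratio j < 1.
Proof.
have /andP[p0 p1] := p_range j.
by rewrite /ratio divr_gt0 ?ltr_pdivrMr; lra.
Qed.

(** Seen from the target, a step goes towards it with probability
    [1 - p j < 1/2]. *)
Lemma up_prob j i m : P [set w | up j i m w] = (ratio j ^+ m)%:E.
Proof.
have /andP[p0 p1] := p_range j.
rewrite (hit_prob coord_measurable coord_setI_closed indepF (@step_inj j i)
  (c := fun u w => ~~ L j i u w) (right_step_event j i) (right_step_prob j i)); last lra.
rewrite hlim_transient; last lra.
by rewrite /ratio subKr.
Qed.

Lemma down_prob j i m : P [set w | down j i m w] = 1%E.
Proof.
have /andP[p0 p1] := p_range j.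
rewrite (hit_prob coord_measurable coord_setI_closed indepF (@step_inj j i)
  (c := fun u w => L j i u w) (step_event j i) (L_law j i)); last lra.
by rewrite hlim_recurrent//; lra.
Qed.

Lemma steps_site j i : steps j i `<=` site @^-1` [set j].
Proof. by move=> _ [k _ <-]. Qed.

Lemma up_on_sites j i m : event (on_sites [set j]) (up j i m).
Proof. exact: event_block_sub (@steps_site j i) (up_event j i m). Qed.

Lemma down_on_sites j i m : event (on_sites [set j]) (down j i m).
Proof. exact: event_block_sub (@steps_site j i) (down_event j i m). Qed.

Lemma count_on_sites j (C : nat -> Prop) : (0 < j)%N ->
  event (on_sites [set j]) (fun w => C (X j w)).
Proof.
move=> j0; apply: (event_preimage (ss _)) => k.
by apply: event_block_sub (count_event k j0) => _ ->; rewrite /= prednK.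
Qed.

Lemma silent_event j m : (0 < j)%N -> event (on_sites [set j]) (silent j m).
Proof.
move=> j0; apply: (event_all (ss _)) => i; apply: (event_imp (ss _)).
  exact: (count_on_sites (fun x => (i < x)%N) j0).
by apply: (event_not (ss _)); exact: up_on_sites.
Qed.

Lemma ratio_compl_itv j m : 0 <= 1 - ratio j ^+ m <= 1.
Proof.
have /andP[r0 r1] := ratio_itv j.
by rewrite subr_ge0 exprn_ile1 ?(ltW r0) ?(ltW r1)//= gerBl exprn_ge0 ?ltW.
Qed.

(** Given [X j = k], the [k] frogs of site [j] independently fail to climb by
    [m], each with probability [1 - ratio j ^+ m]; summing over [k] gives the
    generating function. *)
Lemma silent_prob j m : (0 < j)%N ->
  P [set w | silent j m w] = (pgf P (X j) (1 - ratio j ^+ m))%:E.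
Proof.
move=> j0; have itv := ratio_compl_itv j m; have /andP[s0 s1] := itv.
rewrite pgfE// epgf_series//.
pose none k w := forall i, (0 <= i < k)%N -> ~ up j i m w.
have noneE k : event (block coord_system (\bigcup_i steps j i)) (none k).
  apply: (event_all (sb _)) => i; apply: (event_guard (sb _)) => _.
  apply: (event_not (sb _)); apply: event_block_sub (up_event j i m).
  by move=> u su; exists i.
have noneP k : P [set w | none k w] = ((1 - ratio j ^+ m) ^+ k)%:E.
  rewrite (block_indep_prod coord_measurable coord_setI_closed indepF
    (S := steps j) (x := fun=> 1 - ratio j ^+ m)).
  - by rewrite prodr_const_nat subn0.
  - by move=> i i' _ _ [_ [[k1 _ <-] [k2 _ [->]]]].
  - by move=> i; apply: (event_not (sb _)); exact: up_event.
  - move=> i _; rewrite (_ : [set w | _] = ~` [set w | up j i m w])//.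
    rewrite probability_setC ?up_prob//.
    exact: on_sites_measurable (up_on_sites j i m).
have cE k := count_event k j0.
rewrite (_ : [set w | silent j m w] = \bigcup_k ([set w | X j w = k] `&` [set w | none k w])); last first.
  apply/seteqP; split=> [w h|w [k _ [/= Xk nk]] i]; last by rewrite Xk => ik; exact: nk.
  by exists (X j w) => //; split=> //= i /andP[_]; exact: h.
have mI k : measurable ([set w | X j w = k] `&` [set w | none k w]).
  apply: measurableI; first exact: (event_block_measurable coord_measurable (cE k)).
  exact: (event_block_measurable coord_measurable (noneE k)).
rewrite measure_semi_bigcup//; last 2 first.
- by move=> k l _ _ [w [[/= <- _] [/= <- _]]].
- exact: bigcup_measurable.
apply: eq_eseriesr => k _.
rewrite muleC -noneP; apply: blockI (event_set (cE k)) (event_set (noneE k)).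
by apply/seteqP; split=> // _ [-> [i _ [l _]]].
Qed.

Lemma quiet_event m n : (0 < m)%N ->
  event (on_sites [set j | m <= j < n]%N) (quiet m n).
Proof.
move=> m0; apply: (event_all (ss _)) => j; apply: (event_guard (ss _)) => mjn.
apply: on_sites_sub (silent_event _ _); first by move=> _ ->.
by case/andP: mjn => mj _; exact: leq_trans mj.
Qed.

(** Distinct sites carry independent coordinates. *)
Lemma quiet_prob m n : (0 < m)%N -> P [set w | quiet m n w] =
  (\prod_(m <= j < n) pgf P (X j) (1 - ratio j ^+ (n - j)))%:E.
Proof.
move=> m0.
(* The product rule wants an event at every index, and X 0 is not one of the
     independent coordinates: the guard makes Q 0 trivial. *)
pose Q j w := (0 < j)%N -> silent j (n - j) w.
rewrite -(block_indep_prod coord_measurable coord_setI_closed indepF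
  (S := fun j => site @^-1` [set j]) (Q := Q)).
- congr (P _); apply/seteqP; split=> w h j jn; first by move=> _; exact: h.
  by apply: h => //; case/andP: jn => mj _; exact: leq_trans mj.
- by move=> i j _ _ [u [/= <- <-]].
- by move=> j; apply: (event_guard (sb _)) => j0; exact: silent_event.
- move=> j /andP[mj _]; have j0 := leq_trans m0 mj.
  rewrite -silent_prob//; congr (P _); apply/seteqP; split=> w; first exact.
  by move=> h _.
Qed.

Lemma gap_event n : (0 < n)%N -> event (on_sites [set j | j < n]%N) (gap n).
Proof.
move=> n0; apply: (event_and (ss _)).
  by apply: (event_not (ss _)); apply: on_sites_sub (up_on_sites 0 0 n) => _ ->.
by apply: on_sites_sub (quiet_event n _) => // j /andP[].
Qed.

Lemma gap_prob n : (0 < n)%N -> P [set w | gap n w] =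
  ((1 - ratio 0 ^+ n) * \prod_(1 <= j < n) pgf P (X j) (1 - ratio j ^+ (n - j)))%:E.
Proof.
move=> n0; rewrite EFinM -quiet_prob//.
rewrite (@on_sites_indep [set 0%N] [set j | 1 <= j < n]%N).
- congr (_ * _)%E; rewrite (_ : [set w | _] = ~` [set w | up 0 0 n w])//.
  by rewrite probability_setC ?up_prob//; exact: on_sites_measurable (up_on_sites _ _ _).
- by apply/seteqP; split=> // j [/= -> /andP[]].
- by apply: (event_not (ss _)); exact: up_on_sites.
- exact: quiet_event.
Qed.

End FrogEvents.

(** * Measurability of the visits to the origin *)

(** This rewrites infinity as a countable combination of conditions on single
    pairs. *)
Lemma infinite_pairsP (A : set (nat * nat)) :
  infinite_set A <-> forall N, exists f, (N <= f.1 + f.2)%N /\ A f.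
Proof.
split=> [infA N|h /finite_seqP[s As]].
  apply: contrapT => /forallNP h; apply: infA.
  apply: (@sub_finite_set _ _ (`I_N `*` `I_N)); last first.
    by apply: finite_setX; exact: finite_II.
  move=> [j i] Af; have := h (j, i); rewrite not_andP => -[/negP|//] /=.
  by rewrite -ltnNge /setX /=; lia.
have [f [fN]] := h (\max_(f <- s) (f.1 + f.2)).+1.
rewrite As /= => fs.
have := leq_bigmax_seq (F := fun f : nat * nat => (f.1 + f.2)%N) (P := xpredT) f fs isT.
by rewrite leqNgt fN.
Qed.

Section FrogMeasurability.
Context d (T : measurableType d) (R : realType) (P : probability T R).
Context (X : nat -> {RV P >-> nat}) (L : nat -> nat -> nat -> {RV P >-> bool}).

Let sm : sigma_algebra setT (@measurable d T) := sigma_algebra_measurable T.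
Local Notation mevent := (event (@measurable d T)).

Lemma step_mevent j i k : mevent (fun w => L j i k w).
Proof.
split; rewrite (_ : [set w | _] = setT `&` L j i k @^-1` [set true]).
  exact: (@measurable_funPT _ _ _ _ (L j i k)).
by rewrite setTI; apply/seteqP; split=> w /=; case: (L j i k w).
Qed.

Lemma walk_mevent j i k z : mevent (fun w => walk L j i k w = z).
Proof.
elim: k z => [|k IH] z.
  apply: event_ext (event_const sm (j%:Z = z)) => w.
  by rewrite /walk big_ord0 addr0.
have e := step_mevent j i k.
apply: event_ext (event_or sm (event_and sm e (IH (z + 1)))
  (event_and sm (event_not sm e) (IH (z - 1)))) => w.
rewrite /walk big_ord_recr /=; set S := \sum_(u < k) _.
case: (L j i k w); split=> [[[t h]|[t h]]|h] //; lia.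
Qed.

Lemma frogs_at_mevent j i : mevent (fun w => (i < frogs_at X j w)%N).
Proof.
case: j => [|j]; first exact: (event_const sm (i < 1)%N).
by split; exact: (measurable_count (X j.+1) [set n | (i < n)%N]).
Qed.

Lemma age_mevent n j o : mevent (fun w => age X L w n j = o).
Proof.
elim: n j o => [|n IH] j o; first exact: (event_const sm ((if j == 0%N then Some 0%N else None) = o)).
pose hit w := exists x i a : nat, [/\ (i < frogs_at X x w)%N,
  age X L w n x = Some a & walk L x i a.+1 w = j%:Z].
have eh : mevent hit.
  apply: (event_ex sm) => x; apply: (event_ex sm) => i; apply: (event_ex sm) => a.
  apply: event_ext (event_and sm (frogs_at_mevent x i)
    (event_and sm (IH x (Some a)) (walk_mevent x i a.+1 j%:Z))) => w.
  by split=> [[? []]|[]].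
have eA : mevent (fun w => exists a, age X L w n j = Some a /\ Some a.+1 = o).
  apply: (event_ex sm) => a; apply: (event_and sm) => //.
  exact: (event_const sm).
apply: event_ext (event_or sm eA (event_and sm (IH j None)
  (event_or sm (event_and sm eh (event_const sm (Some 0%N = o)))
    (event_and sm (event_not sm eh) (event_const sm (None = o)))))) => w /=.
case: (age X L w n j) => [a|].
  by split=> [[[b [[->]]]//|[]//]|h]; left; exists a.
rewrite -/(hit w); case: asboolP => hw; split.
- by move=> [[b []]//|[_ [[]|[]]]].
- by move=> h; right; split=> //; left.
- by move=> [[b []]//|[_ [[]|[]]]].
- by move=> h; right; split=> //; right.
Qed.

Lemma hits_origin_mevent f : mevent (fun w => hits_origin X L w f).
Proof.
apply: (event_and sm); first exact: frogs_at_mevent.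
apply: (event_ex sm) => n; apply: (event_ex sm) => a.
by apply: (event_and sm); [exact: age_mevent|exact: walk_mevent].
Qed.

(** Measurability is needed to bound the probability of this set from above by
    inclusion in a null event. *)
Lemma infinite_hits_measurable :
  measurable [set w | infinite_set [set f | hits_origin X L w f]].
Proof.
apply: event_set.
apply: (@event_ext _ _ (fun w => forall N, exists f : nat * nat,
    (N <= f.1 + f.2)%N /\ hits_origin X L w f)).
  by move=> w; rewrite infinite_pairsP.
apply: (event_all sm) => N; apply: (event_ex sm) => f.
by exact: (event_and sm (event_const sm _) (hits_origin_mevent f)).
Qed.

End FrogMeasurability.

(** * A renewal inequality *)

Section RenewalInequality.
Context (R : realType).

Lemma sum_convolution (f g : nat -> R) N :
  \sum_(n < N) \sum_(m < n.+1) f m * g (n.+1 - m)%N =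
  \sum_(m < N) f m * \sum_(k < N - m) g k.+1.
Proof.
elim: N => [|N IH]; first by rewrite !big_ord0.
rewrite big_ord_recr /= {}IH.
transitivity (\sum_(m < N.+1) (f m * (\sum_(k < N - m) g k.+1) + f m * g (N.+1 - m)%N)).
  rewrite big_split /=; congr (_ + _).
  by rewrite [RHS]big_ord_recr /= subnn big_ord0 mulr0 addr0.
apply: eq_bigr => m _; have mN : (m <= N)%N by rewrite -ltnS.
by rewrite -mulrDr (subSn mN) big_ord_recr.
Qed.

(** In the application [g m] is the probability that none of the sites 1, ..., [m]
    is a gap, so that [g m - g m.+1] is the law of the first gap. Summing the
    hypothesis over [n < N], the convolution is at most [1 - g N] times the sum
    of the [b n.+1], while the left-hand sides fall short of that sum by at most
    a geometric series. *)
Lemma renewal_bound (b g : nat -> R) (r : R) : 0 <= r < 1 ->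
  (forall n, 0 <= b n <= 1) -> g 0%N = 1 -> (forall m, g m.+1 <= g m) ->
  (forall n, (1 - r ^+ n.+1) * b n.+1 <=
     \sum_(m < n.+1) (g m - g m.+1) * b (n.+1 - m)%N) ->
  forall N, g N * \sum_(n < N) b n.+1 <= (1 - r)^-1.
Proof.
move=> /andP[r0 r1] b01 g0 gdec renew N.
set S := \sum_(n < N) b n.+1.
have b_ge0 n : 0 <= b n by case/andP: (b01 n).
have tele : \sum_(m < N) (g m - g m.+1) = 1 - g N.
  rewrite -(big_mkord xpredT (fun m => g m - g m.+1)).
  by under eq_bigr do rewrite -opprB; rewrite sumrN telescope_sumr// opprB g0.
have upper : \sum_(n < N) (1 - r ^+ n.+1) * b n.+1 <= (1 - g N) * S.
  apply: le_trans (ler_sum _ (fun (n : 'I_N) _ => renew n)) _.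
  rewrite (sum_convolution (fun m => g m - g m.+1)) -tele mulr_suml.
  apply: ler_sum => m _; apply: ler_wpM2l; first by rewrite subr_ge0.
  rewrite /S -(big_mkord xpredT (fun k => b k.+1)) -(big_mkord xpredT (fun k => b k.+1)).
  rewrite [leRHS](@big_cat_nat _ _ _ (N - m))//= ?leq_subr// lerDl.
  exact: sumr_ge0.
have lower : S - (1 - r)^-1 <= \sum_(n < N) (1 - r ^+ n.+1) * b n.+1.
  have geo : \sum_(n < N) r ^+ n <= (1 - r)^-1.
    rewrite -[leRHS]div1r ler_pdivlMr ?subr_gt0// mulrC -[1 - r]opprB mulNr -subrX1 opprB.
    by rewrite gerBl exprn_ge0.
  apply: le_trans (lerB (lexx S) geo) _.
  rewrite /S -sumrB; apply: ler_sum => n _.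
  rewrite mulrBl mul1r lerB// -[leRHS]mulr1 exprSr; have /andP[? ?] := b01 n.+1.
  rewrite -mulrA; apply: ler_pM; rewrite ?exprn_ge0 ?mulr_ge0//; nra.
by move: (le_trans lower upper); rewrite mulrBl mul1r; lra.
Qed.

End RenewalInequality.

(** * Divergence of the series: some site is a gap *)

Section FrogModel.
Context (R : realType) (d : measure_display) (T : measurableType d).
Context (P : probability T R).
Context (X : nat -> {RV P >-> nat}) (L : nat -> nat -> nat -> {RV P >-> bool}).
Context (p : nat -> R).
Hypothesis X_dom : forall j k : nat, (1 <= j)%N ->
  (P [set w | (k <= X j w)%N] <= P [set w | (k <= X j.+1 w)%N])%E.
Hypothesis p_range : forall j : nat, 1 / 2 < p j < 1.
Hypothesis p_decr : forall j : nat, (1 <= j)%N -> p j.+1 <= p j.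
Hypothesis L_law : forall j i k : nat, P [set w | L j i k w = true] = (p j)%:E.
Hypothesis indep : frog_independence X L.

Local Notation ratio := (ratio p).
Local Notation on_sites := (on_sites X L).
Local Notation gap := (gap X L).
Local Notation quiet := (quiet X L).
Let ss D : sigma_algebra setT (on_sites D) := block_sigma_algebra _ _.

(** A real-valued probability, so that inequalities can be added and
    subtracted. *)
Definition pr (Q : T -> Prop) : R := fine (P [set w | Q w]).

Lemma prE D Q : event (on_sites D) Q -> P [set w | Q w] = (pr Q)%:E.
Proof.
by move=> /on_sites_measurable mQ; rewrite /pr fineK// fin_num_measure.
Qed.

Lemma pr_le D E Q Q' : event (on_sites D) Q -> event (on_sites E) Q' ->
  (forall w, Q w -> Q' w) -> pr Q <= pr Q'.
Proof.
move=> eQ eQ' QQ'; rewrite -lee_fin -(prE eQ) -(prE eQ').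
by apply: le_measure; rewrite ?inE; [exact: on_sites_measurable eQ|exact: on_sites_measurable eQ'|].
Qed.

Lemma pr_ge0 Q : 0 <= pr Q.
Proof. by rewrite /pr fine_ge0. Qed.

Lemma pr_split D E Q Q' : event (on_sites D) Q -> event (on_sites E) Q' ->
  pr Q = pr (fun w => Q w /\ Q' w) + pr (fun w => Q w /\ ~ Q' w).
Proof.
move=> eQ eQ'.
have sT : forall C : set nat, C `<=` setT by [].
have e := on_sites_sub (sT _) eQ; have e' := on_sites_sub (sT _) eQ'.
apply: EFin_inj; rewrite EFinD.
rewrite -(prE eQ) -(prE (event_and (ss _) e e')).
rewrite -(prE (event_and (ss _) e (event_not (ss _) e'))) addeC.
exact: measureDI (on_sites_measurable eQ) (on_sites_measurable eQ').
Qed.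

Lemma pr_indep D E Q Q' : D `&` E = set0 -> event (on_sites D) Q ->
  event (on_sites E) Q' -> pr (fun w => Q w /\ Q' w) = pr Q * pr Q'.
Proof.
move=> DE eQ eQ'; rewrite /pr (on_sites_indep indep DE eQ eQ').
by rewrite (prE eQ) (prE eQ').
Qed.

(** The general term of the series of the theorem. *)
Definition quiet_weight n : R :=
  \prod_(1 <= j < n) pgf P (X j) (1 - ratio j ^+ (n - j)).

Let factor_itv j m : 0 <= pgf P (X j) (1 - ratio j ^+ m) <= 1.
Proof. by apply: pgf_itv; exact: ratio_compl_itv. Qed.

Lemma quiet_weight_itv n : 0 <= quiet_weight n <= 1.
Proof.
rewrite /quiet_weight; apply/andP; split.
  by apply: prodr_ge0 => j _; have /andP[] := factor_itv j (n - j).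
by apply: prodr_ile1 => j _; exact: factor_itv.
Qed.

Lemma p_nonincr i j : (0 < i)%N -> (i <= j)%N -> p j <= p i.
Proof.
move=> i0 /subnK <-; elim: (j - i)%N => //= n IH.
by rewrite addSn; apply: le_trans IH; apply: p_decr; rewrite ltn_addl.
Qed.

Lemma X_dominance i j k : (0 < i)%N -> (i <= j)%N ->
  (P [set w | (k <= X i w)%N] <= P [set w | (k <= X j w)%N])%E.
Proof.
move=> i0 /subnK <-; elim: (j - i)%N => //= n IH.
by rewrite addSn; apply: le_trans IH _; apply: X_dom; rewrite ltn_addl.
Qed.

Lemma ratio_nondecr i j : (0 < i)%N -> (i <= j)%N -> ratio i <= ratio j.
Proof.
move=> i0 ij; have := p_nonincr i0 ij.
have /andP[? ?] := p_range i; have /andP[? ?] := p_range j => h.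
rewrite /ratio ler_pdivrMr; last lra.
rewrite mulrAC ler_pdivlMr; last lra.
by rewrite !mulrBl !mul1r [p j * p i]mulrC; lra.
Qed.

(** Farther to the right there are stochastically more frogs and their drift to
    the left is weaker: both make it less likely that none of them climbs by
    [m]. *)
Lemma silent_factor_le i j m : (0 < i)%N -> (i <= j)%N ->
  pgf P (X j) (1 - ratio j ^+ m) <= pgf P (X i) (1 - ratio i ^+ m).
Proof.
move=> i0 ij; have /andP[r0 r1] := ratio_itv p_range i.
have /andP[s0 s1] := ratio_itv p_range j.
have /andP[a0 a1] := ratio_compl_itv p_range i m.
have /andP[b0 b1] := ratio_compl_itv p_range j m.
apply: (@le_trans _ _ (pgf P (X i) (1 - ratio j ^+ m))).
  by apply: pgf_dominance => [|k]; [rewrite b0|exact: X_dominance].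
apply: pgf_le => //; apply: lerB => //.
by apply: lerXn2r; rewrite ?nnegrE; [exact: ltW|exact: ltW|exact: ratio_nondecr].
Qed.

(** The sites of [[m, n)] are compared one by one with the sites of
    [[1, n - m + 1)] by a shift that preserves the distance to the target. *)
Lemma quiet_le m n : (0 < m <= n)%N -> pr (quiet m n) <= quiet_weight (n - m).+1.
Proof.
move=> /andP[m0 mn].
have -> : pr (quiet m n) = \prod_(m <= j < n) pgf P (X j) (1 - ratio j ^+ (n - j)).
  by rewrite /pr (quiet_prob p_range L_law indep).
rewrite -{1}(prednK m0) -add1n big_addn -subn1 subnBA// addn1 subSn//.
rewrite /quiet_weight big_nat [leRHS]big_nat; apply: ler_prod => j /andP[j1 jn].
have /andP[-> _] := factor_itv (j + (m - 1)) (n - (j + (m - 1))).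
rewrite (_ : n - (j + (m - 1)) = (n - m).+1 - j)%N; last by lia.
by apply: silent_factor_le => //; rewrite leq_addr.
Qed.

Definition no_gap m w := forall l, (0 < l <= m)%N -> ~ gap l w.

Lemma gap_ev n : (0 < n)%N -> event (on_sites [set j | j < n]%N) (gap n).
Proof. exact: gap_event. Qed.

Lemma no_gap_event m : event (on_sites [set j | j < m]%N) (no_gap m).
Proof.
apply: (event_all (ss _)) => l; apply: (event_guard (ss _)) => /andP[l0 lm].
apply: (event_not (ss _)); apply: on_sites_sub (gap_ev l0) => j /=.
by move=> jl; exact: leq_trans lm.
Qed.

Lemma no_gapS m w : no_gap m.+1 w <-> no_gap m w /\ ~ gap m.+1 w.
Proof.
split=> [h|[h hm] l /andP[l0]].
  split=> [l /andP[l0 lm]|]; apply: h; rewrite ?l0 ?ltnSn//.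
  exact: leqW.
by rewrite leq_eqVlt => /orP[/eqP ->//|lm]; apply: h; rewrite l0.
Qed.

Lemma first_gap_pr m :
  pr (fun w => no_gap m w /\ gap m.+1 w) = pr (no_gap m) - pr (no_gap m.+1).
Proof.
rewrite (pr_split (no_gap_event m) (gap_ev (ltn0Sn m))).
rewrite (_ : no_gap m.+1 = fun w => no_gap m w /\ ~ gap m.+1 w) ?addrK//.
by apply/funext => w; apply/propext; exact: no_gapS.
Qed.

(** Decomposition along the first gap [m.+1]. The frogs below a gap never get
    past it, so a further gap at [n.+1] only asks that the sites from [m.+1] to
    [n] be quiet; this is independent of what happens below [m.+1], and
    [quiet_le] bounds its probability. *)
Lemma gap_renewal n : pr (gap n.+1) <=
  \sum_(m < n.+1) (pr (no_gap m) - pr (no_gap m.+1)) * quiet_weight (n.+1 - m).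
Proof.
have sT : forall C : set nat, C `<=` setT by [].
have eG l : (0 < l)%N -> event (on_sites setT) (gap l).
  by move=> l0; exact: on_sites_sub (sT _) (gap_ev l0).
have eN l : event (on_sites setT) (no_gap l).
  exact: on_sites_sub (sT _) (no_gap_event l).
have eGN l := event_and (ss _) (eG n.+1 isT) (eN l).
(* The first k terms account for the outcomes with a gap among 1, ..., k;
   at k = n.+1 no other outcome is left. *)
suff main k : (k <= n.+1)%N -> pr (gap n.+1) <=
    \sum_(m < k) (pr (no_gap m) - pr (no_gap m.+1)) * quiet_weight (n.+1 - m)
    + pr (fun w => gap n.+1 w /\ no_gap k w).
  apply: le_trans (main _ (leqnn _)) _; rewrite gerDl.
  have -> : pr (fun w => gap n.+1 w /\ no_gap n.+1 w) = 0; last by [].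
  rewrite /pr (_ : [set w | _] = set0) ?measure0//.
  apply/seteqP; split=> // w [g ng]; apply: (ng n.+1) => //.
  by rewrite leqnn.
elim: k => [_|k IH kn].
  rewrite big_ord0 add0r; apply: pr_le (eG _ _) (eGN 0%N) _ => // w g.
  by split=> // l /andP[l0 l1]; move: (leq_trans l0 l1).
apply: le_trans (IH (ltnW kn)) _; rewrite big_ord_recr /= -addrA lerD2l.
rewrite (pr_split (eGN k) (eG k.+1 isT)).
apply: lerD; last first.
  apply: pr_le (event_and (ss _) (eGN k) (event_not (ss _) (eG k.+1 isT))) (eGN k.+1) _.
  by move=> w [[g ng] ngk]; split=> //; apply/no_gapS.
rewrite -first_gap_pr.
have eF : event (on_sites [set j | j < k.+1]%N) (fun w => no_gap k w /\ gap k.+1 w).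
  apply: (event_and (ss _)); last exact: gap_ev.
  by apply: on_sites_sub (no_gap_event k) => j /= /ltnW.
have eq := @quiet_event _ _ _ P X L k.+1 n.+1 isT.
apply: (@le_trans _ _ (pr (fun w => (no_gap k w /\ gap k.+1 w) /\ quiet k.+1 n.+1 w))).
  apply: pr_le (event_and (ss _) (eGN k) (eG k.+1 isT)) _ _.
    exact: (event_and (ss setT) (on_sites_sub (sT _) eF) (on_sites_sub (sT _) eq)).
  move=> w [[[_ q] ng] g]; split=> // j /andP[kj jn]; apply: q.
  by rewrite jn (leq_trans _ kj).
rewrite (pr_indep _ eF eq); last first.
  by apply/seteqP; split=> // j [/= jk /andP[kj _]]; move: (leq_trans jk kj); rewrite ltnn.
apply: ler_wpM2l; first exact: pr_ge0.
have := @quiet_le k.+1 n.+1 kn.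
by rewrite -subSn.
Qed.

Lemma partial_sum_bound N :
  pr (no_gap N) * \sum_(n < N) quiet_weight n.+1 <= (1 - ratio 0)^-1.
Proof.
have /andP[r0 r1] := ratio_itv p_range 0.
apply: (renewal_bound (g := fun m => pr (no_gap m)) (r := ratio 0)).
- by rewrite ltW.
- exact: quiet_weight_itv.
- rewrite /pr (_ : [set w | _] = setT) ?probability_setT//.
  apply/seteqP; split=> // w _ l /andP[l0 l1].
  by move: (leq_trans l0 l1).
- move=> m; rewrite -subr_ge0 -first_gap_pr; exact: pr_ge0.
- move=> n; have := gap_renewal n.
  by rewrite {1}/pr (gap_prob p_range L_law indep).
Qed.

(** Equivalently, every site wakes up ([no_gap_woken], [gap_age]). *)
Definition percolates w := forall n, (0 < n)%N -> ~ gap n w.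

Lemma percolates_event : event (on_sites setT) percolates.
Proof.
apply: (event_all (ss _)) => n; apply: (event_guard (ss _)) => n0.
apply: (event_not (ss _)); exact: on_sites_sub (gap_ev n0).
Qed.

(** A positive probability of percolation would bound all the partial sums, by
    [partial_sum_bound]. *)
Lemma divergence_no_percolation :
  (\sum_(2 <= n <oo) (quiet_weight n)%:E = +oo)%E -> pr percolates = 0.
Proof.
move=> sum_oo; apply/eqP; rewrite eq_le pr_ge0 andbT leNgt; apply/negP => pos.
have /andP[r0 r1] := ratio_itv p_range 0.
set K := (1 - ratio 0)^-1 / pr percolates.
have bound N : \sum_(n < N) quiet_weight n.+1 <= K.
  rewrite ler_pdivlMr// mulrC; apply: le_trans (partial_sum_bound N).
  apply: ler_wpM2r.
    by apply: sumr_ge0 => n _; have /andP[] := quiet_weight_itv n.+1.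
  apply: pr_le percolates_event (no_gap_event N) _ => w perc l /andP[l0 _].
  exact: perc.
suff : (\sum_(2 <= n <oo) (quiet_weight n)%:E <= K%:E)%E by rewrite sum_oo.
apply: lime_le.
  by apply: is_cvg_nneseries => n _ _; rewrite lee_fin; have /andP[] := quiet_weight_itv n.
near=> N; rewrite sumEFin lee_fin; apply: le_trans (bound N).
rewrite -(big_mkord xpredT (fun n => quiet_weight n.+1)) -(big_add1 _ _ 0 N.+1 xpredT).
have N2 : (2 <= N)%N by near: N; exact: nbhs_infty_ge.
rewrite [leRHS](@big_cat_nat _ _ _ 2)//=; last by rewrite ltnW.
rewrite [X in _ + X](@big_cat_nat _ _ _ N)//=.
have ge0 m n : 0 <= \sum_(m <= k < n) quiet_weight k.
  by apply: sumr_ge0 => k _; have /andP[] := quiet_weight_itv k.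
by have := ge0 1 2; have := ge0 N N.+1; lra.
Unshelve. all: by end_near. Qed.

(** A gap confines the active frogs to finitely many sites ([gap_finite]). *)
Lemma transient_no_percolation : pr percolates = 0 -> transient P X L.
Proof.
move=> p0; have mI := infinite_hits_measurable X L.
apply/eqP; rewrite -measure_le0 -[leRHS]/(0%:E) -p0 -(prE percolates_event).
apply: le_measure; rewrite ?inE//; first exact: on_sites_measurable percolates_event.
move=> w inf n n0 g; apply: inf; exact: gap_finite g.
Qed.

End FrogModel.

(** * Convergence of the series: all sites may wake up *)

Section Percolation.
Context (R : realType) (d : measure_display) (T : measurableType d).
Context (P : probability T R).
Context (X : nat -> {RV P >-> nat}) (L : nat -> nat -> nat -> {RV P >-> bool}).
Context (p : nat -> R).
Hypothesis p_range : forall j : nat, 1 / 2 < p j < 1.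
Hypothesis L_law : forall j i k : nat, P [set w | L j i k w = true] = (p j)%:E.
Hypothesis indep : frog_independence X L.

Local Notation ratio := (ratio p).
Local Notation on_sites := (on_sites X L).
Local Notation gap := (gap X L).
Local Notation quiet := (quiet X L).
Local Notation up := (up L).
Local Notation down := (down L).
Let ss D : sigma_algebra setT (on_sites D) := block_sigma_algebra _ _.

Definition null (Q : T -> Prop) := P.-negligible [set w | Q w].

Lemma null_ex (Q : nat -> T -> Prop) :
  (forall n, null (Q n)) -> null (fun w => exists n, Q n w).
Proof.
move=> nQ; rewrite /null (_ : [set w | _] = \bigcup_n [set w | Q n w]).
  exact: negligible_bigcup.
by apply/seteqP; split=> w [n]; exists n.
Qed.

Lemma down_null j i m : null (fun w => ~ down j i m w).
Proof.
have md : measurable [set w | down j i m w].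
  exact: on_sites_measurable (down_on_sites X L j i m).
apply/negligibleP; first exact: measurableC.
apply: etrans (probability_setC P md) _.
by rewrite (down_prob p_range L_law indep) subee.
Qed.

(** The probability of climbing by [m] tends to 0 as [m] grows. *)
Lemma unbounded_null j i : null (fun w => forall m, up j i m w).
Proof.
have eU : event (on_sites [set j]) (fun w => forall m, up j i m w).
  by apply: (event_all (ss _)) => m; exact: up_on_sites.
apply/negligibleP; first exact: on_sites_measurable eU.
apply: etrans (prE eU) _; congr EFin; apply/eqP; rewrite eq_le pr_ge0 andbT.
have /andP[r0 r1] := ratio_itv p_range j.
have c : ratio j ^+ m @[m --> \oo] --> (0 : R).
  by apply: cvg_expr; rewrite ger0_norm ?ltW.
rewrite -(cvg_lim _ c)//; apply: limr_ge; first by apply/cvg_ex; eexists; exact: c.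
near=> m.
have -> : ratio j ^+ m = pr P (up j i m) by rewrite /pr (up_prob p_range L_law indep).
exact: pr_le eU (up_on_sites X L j i m) _.
Unshelve. all: by end_near. Qed.

(** Every trajectory passes through the origin and is bounded above. *)
Definition regular w := (forall j i, down j i j w) /\
  (forall j i, exists m, ~ up j i m w).

Lemma regular_null : null (fun w => ~ regular w).
Proof.
have n1 : null (fun w => exists j i, ~ down j i j w).
  by apply: null_ex => j; apply: null_ex => i; exact: down_null.
have n2 : null (fun w => exists j i, forall m, up j i m w).
  by apply: null_ex => j; apply: null_ex => i; exact: unbounded_null.
apply: negligibleS (negligibleU n1 n2) => w /not_andP[|].
  by move=> /existsNP[j /existsNP[i h]]; left; exists j, i.
move=> /existsNP[j /existsNP[i /forallNP h]]; right; exists j, i => m.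
by apply: contrapT; exact: h.
Qed.

Lemma reach_all_true (c : nat -> bool) m : (forall k, (k < m)%N -> c k) -> reach c m m.
Proof.
elim: m c => [|m IH] c h //=; rewrite h//.
by apply: IH => k km; exact: h.
Qed.

(** If the series converges, then for [N] large the sites from [N] on are all
    reached by frogs of the sites 1, 2, ... with positive probability. This event
    does not involve the frog of the origin, which independently starts with [N]
    steps to the right with positive probability and so wakes up the sites up to
    [N]. On the intersection there is no gap, and, outside of the null set of
    irregular outcomes, infinitely many frogs hit the origin. *)
Lemma transient_divergence : transient P X L ->
  (\sum_(2 <= n <oo) (quiet_weight X p n)%:E = +oo)%E.
Proof.
move=> tr; apply: contrapT => /eqP; rewrite -ltey => fin_sum.
pose b n := quiet_weight X p n.
have b0 n : (0 <= (b n)%:E)%E by rewrite lee_fin; have /andP[] := quiet_weight_itv X p_range n.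
have tail : exists N, (\sum_(N <= n <oo) (b n)%:E < 1)%E.
  have total : (\sum_(0 <= n <oo) (b n)%:E < +oo)%E.
    rewrite (@nneseries_split _ _ 0%N 2)//= add0n lte_add_pinfty//.
    by rewrite sumEFin ltry.
  have c := nneseries_tail_cvg total (fun k _ => b0 k).
  have [N0 _ hN0] : \forall N \near \oo, (\sum_(N <= n <oo) (b n)%:E < 1)%E.
    by apply: (c [set x | (x < 1)%E]); apply: open_ereal_lt'; rewrite lte_fin.
  by exists N0; apply: hN0 => /=.
have [N tailN] := tail.
(* Shifting by N turns the condition n >= N into a quantifier over all n. *)
pose E w := forall n, ~ quiet 1 (n + N) w.
pose U w := forall k, (0 <= k < N)%N -> ~~ L 0 0 k w.
have eq n : event (on_sites [set j | 0 < j]%N) (quiet 1 n).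
  by apply: on_sites_sub (quiet_event (P := P) X L n (ltn0Sn 0)) => j /andP[].
have eE : event (on_sites [set j | 0 < j]%N) E.
  by apply: (event_all (ss _)) => n; apply: (event_not (ss _)); exact: eq.
have eU : event (on_sites [set 0%N]) U.
  apply: (event_all (ss _)) => k; apply: (event_guard (ss _)) => _.
  by apply: event_block_sub (right_step_event X L 0 0 k) => _ ->.
have eN : event (on_sites [set j | 0 < j]%N) (fun w => exists n, quiet 1 (n + N) w).
  by apply: (event_ex (ss _)) => n; exact: eq.
have prE_gt0 : 0 < pr P E.
  have -> : pr P E = 1 - pr P (fun w => exists n, quiet 1 (n + N) w).
    apply: EFin_inj; rewrite EFinB -(prE eE) -(prE eN).
    rewrite -probability_setC; last exact: on_sites_measurable eN.
    by congr (P _); apply/seteqP; split=> w /= /forallNP.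
  have mq n := on_sites_measurable (eq (n + N)).
  rewrite subr_gt0 -lte_fin -(prE eN); apply: le_lt_trans tailN.
  rewrite (_ : [set w | _] = \bigcup_n [set w | quiet 1 (n + N) w]); last first.
    by apply/seteqP; split=> w [n]; exists n.
  apply: le_trans (generalized_Boole_inequality _ mq _) _.
    exact: bigcup_measurable.
  rewrite -nneseries_addn//; apply: lee_nneseries => // n _.
  have := lexx (b (n + N)%N)%:E.
  by rewrite -{1}(quiet_prob p_range L_law indep).
have prU_gt0 : 0 < pr P U.
  have -> : pr P U = \prod_(0 <= k < N) (1 - p 0%N).
    rewrite /pr /U (block_indep_prod (coord_measurable (X := X) (L := L))
      (coord_setI_closed (X := X) (L := L)) indep
      (S := fun k => [set inr (0%N, 0%N, k)]) (Q := fun k w => ~~ L 0 0 k w)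
      (x := fun=> 1 - p 0%N))//.
    - by move=> k l _ _ [_ [/= -> []]].
    - by move=> k; exact: right_step_event.
    - by move=> k _; exact: right_step_prob L_law _ _ _.
  by apply: prodr_gt0 => k _; rewrite subr_gt0; have /andP[] := p_range 0.
have EU0 : pr P (fun w => E w /\ U w) = 0.
  rewrite /pr (_ : P _ = 0%E)//; apply/negligibleP.
    by apply: measurableI; [exact: on_sites_measurable eE|exact: on_sites_measurable eU].
  have nI : null (fun w => infinite_set [set f | hits_origin X L w f]).
    by apply/negligibleP; first exact: infinite_hits_measurable.
  apply: negligibleS (negligibleU regular_null nI) => w [Ew Uw].
  have [rw|] := pselect (regular w); last by left.
  right; apply: no_gap_infinite; [|exact: rw.1|exact: rw.2].
  move=> n n0 [nup q]; have [Nn|nN] := leqP N n.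
    by apply: (Ew (n - N)%N); rewrite subnK.
  apply: nup; exists n; apply: reach_all_true => k kn.
  by apply: Uw; exact: ltn_trans nN.
have := mulr_gt0 prE_gt0 prU_gt0.
rewrite -(pr_indep indep _ eE eU) ?EU0 ?ltxx//.
by apply/seteqP; split=> // j [/= j0 jj]; rewrite jj in j0.
Qed.

End Percolation.

(** * The transience criterion *)

Theorem theorem1p1 (R : realType) (d : measure_display) (T : measurableType d)
    (P : probability T R)
    (X : nat -> {RV P >-> nat})
    (L : nat -> nat -> nat -> {RV P >-> bool})
    (p : nat -> R)
    (X_pos : forall j : nat, (1 <= j)%N ->
       (0 < P [set w | (1 <= X j w)%N])%E)
    (X_dom : forall j k : nat, (1 <= j)%N ->
       (P [set w | (k <= X j w)%N] <= P [set w | (k <= X j.+1 w)%N])%E)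
    (p_range : forall j : nat, 1 / 2 < p j < 1)
    (p_decr : forall j : nat, (1 <= j)%N -> p j.+1 <= p j)
    (L_law : forall j i k : nat, P [set w | L j i k w = true] = (p j)%:E)
    (indep : frog_independence X L) :
  transient P X L <->
  (\sum_(2 <= n <oo)
     (\prod_(1 <= j < n)
        pgf P (X j) (1 - ((1 - p j) / p j) ^+ (n - j)))%R%:E = +oo)%E.
Proof.
split=> [tr|div].
  exact: (transient_divergence p_range L_law indep tr).
apply: transient_no_percolation.
exact: (divergence_no_percolation X_dom p_range p_decr L_law indep div).
Qed.
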